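(* Let $L > \mu > 0$, let $\kappa = L/\mu$, and let $\hat K$, $\hat K_1$, $\hat K_2 \subset \mathbb{C}$ and $\hat\rho(\cdot)$ be as defined in the context. Then the optimal momentum parameter is negative, i.e. the $\beta$-component of an optimal pair $(\eta,\beta)$ in the min-max problem defining $\hat\rho(\hat K)$ satisfies $\beta<0$. Moreover, as $\kappa\to\infty$, $$\hat\rho(\hat K_1) = 1-\Theta(\kappa^{-1.5}),\qquad \hat\rho(\hat K_2) = 1-\Theta(\kappa^{-1.5}),$$ and therefore $$\hat\rho(\hat K) = 1-\Theta(\kappa^{-1.5}).$$ Furthermore, let $F:\mathbb{R}^d\to\mathbb{R}^d$ be continuously differentiable, $\mu$-strongly monotone and $L$-Lipschitz, and let $\mathbf{z}^*$ be the point with $F(\mathbf{z}^* )=\mathbf{0}$. Then, for $\mathbf{z}_0$ close to $\mathbf{z}^*$, negative momentum (with suitable parameters $\eta$ and $\beta<0$) converges to $\mathbf{z}^*$ asymptotically with rate $1-\Theta(\kappa^{-1.5})$. That is, there are parameters $\eta=\eta(\mu,L)$, $\beta=\beta(\mu,L)<0$ and a rate $\rho_\kappa = 1-\Theta(\kappa^{-1.5})$ such that for every such $F$ there exist a neighborhood $U$ of $\mathbf{z}^*$ and a constant $C$ with $\|\mathbf{z}_t-\mathbf{z}^*\|_2\le C\rho_\kappa^{\,t}\|\mathbf{z}_0-\mathbf{z}^*\|_2$ for all $t\ge 0$ whenever $\mathbf{z}_0\in U$.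
   Context: Assumptions on $F$. $F$ is $\mu$-strongly monotone if $(F(\mathbf{z}_1)-F(\mathbf{z}_2))^\top(\mathbf{z}_1-\mathbf{z}_2)\ge \mu\|\mathbf{z}_1-\mathbf{z}_2\|_2^2$ for all $\mathbf{z}_1,\mathbf{z}_2\in\mathbb{R}^d$, and $L$-Lipschitz if $\|F(\mathbf{z}_1)-F(\mathbf{z}_2)\|_2\le L\|\mathbf{z}_1-\mathbf{z}_2\|_2$ for all $\mathbf{z}_1,\mathbf{z}_2\in\mathbb{R}^d$. (For the minimax problem $\min_{\mathbf{x}}\max_{\mathbf{y}} f(\mathbf{x},\mathbf{y})$ one takes $F(\mathbf{z})=[\nabla_{\mathbf{x}}f(\mathbf{x},\mathbf{y})^\top,-\nabla_{\mathbf{y}}f(\mathbf{x},\mathbf{y})^\top]^\top$ with $\mathbf{z}=[\mathbf{x}^\top,\mathbf{y}^\top]^\top$.) Polyak momentum with step size $\eta\in\mathbb{R}$ and momentum parameter $\beta\in\mathbb{R}$ is the iteration $$\mathbf{z}_{t+1}=(1+\beta)\mathbf{z}_t-\beta\mathbf{z}_{t-1}-\eta F(\mathbf{z}_t),\qquad t\ge 0,$$ started with $\mathbf{z}_{-1}=\mathbf{z}_0$; it is called negative momentum when $\beta<0$. For a set $K\subset\mathbb{C}$ define $$\hat\rho(K)=\min_{\eta,\beta\in\mathbb{R}}\ \sup_{\lambda\in K}\ \rho\!\left(\begin{bmatrix}1+\beta-\eta\lambda & -\beta\\ 1 & 0\end{bmatrix}\right),$$ where $\rho(\cdot)$ of a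 matrix is its spectral radius. The sets are $$\hat K=\{\lambda\in\mathbb{C}: |\lambda|<L,\ \Re\lambda>\mu\},$$ $$\hat K_1=\Big\{\lambda\in\mathbb{C}:\Re\lambda\ge\mu,\ \tfrac1L\Re\lambda+\tfrac{L-\mu}{L\sqrt{L^2-\mu^2}}\Im\lambda\le 1,\ \tfrac1L\Re\lambda-\tfrac{L-\mu}{L\sqrt{L^2-\mu^2}}\Im\lambda\le 1\Big\}$$ (the closed triangle with vertices $L$, $\mu\pm\sqrt{L^2-\mu^2}\,i$), and $$\hat K_2=\{\lambda\in\mathbb{C}:\mu\le\Re\lambda\le L,\ -\sqrt{L^2-\mu^2}\le\Im\lambda\le\sqrt{L^2-\mu^2}\}.$$ The notation $g=1-\Theta(\kappa^{-1.5})$ means that there are absolute constants $0<c_1\le c_2$ such that $c_1\kappa^{-1.5}\le 1-g\le c_2\kappa^{-1.5}$ for all sufficiently large $\kappa$. *)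

(* Defs.v *)
(* Built on MathComp-Analysis and the complex numbers R[i] of real-closed. *)
From HB Require Import structures.
From mathcomp Require Import all_boot all_order all_algebra.
From mathcomp Require Import all_classical all_reals all_analysis.
From mathcomp.real_closed Require Import complex.

Set Implicit Arguments.
Unset Strict Implicit.
Unset Printing Implicit Defensive.

Import Order.TTheory GRing.Theory Num.Theory.
Import numFieldNormedType.Exports.

Local Open Scope classical_set_scope.
Local Open Scope ring_scope.

Section MinMax.
Variable R : realType.
Implicit Types (mu L eta beta : R) (K : set R[i]).

(* [Normc.normc] is the modulus with values in R; [`|z|] has type R[i]. *)
Definition spectral_radius n (A : 'M[R[i]]_n) : R :=
  sup [set Normc.normc a | a in [set a : R[i] | eigenvalue A a]].

Definition momentum_mx eta beta (lambda : R[i]) : 'M[R[i]]_2 :=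
  block_mx (1 + beta%:C%C - eta%:C%C * lambda)%:M (- beta%:C%C)%:M
           (1%:M : 'M[R[i]]_1)                    (0 : 'M[R[i]]_1).

(* The supremum and the infimum are taken in \bar R, so that no boundedness
   assumption on K is needed. *)
Definition worst_radius K eta beta : \bar R :=
  ereal_sup [set (spectral_radius (momentum_mx eta beta lambda))%:E
            | lambda in K].

Definition rho_hat K : \bar R :=
  ereal_inf [set worst_radius K p.1 p.2 | p in [set: R * R]].

(* (eta, beta) attains the infimum [rho_hat K]. *)
Definition optimal_pair K eta beta : Prop := worst_radius K eta beta = rho_hat K.

Definition K_hat mu L : set R[i] :=
  [set l | Normc.normc l < L /\ mu < complex.Re l].

Definition K1_hat mu L : set R[i] :=
  [set l | [/\ mu <= complex.Re l,
      L^-1 * complex.Re l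
        + (L - mu) / (L * Num.sqrt (L ^+ 2 - mu ^+ 2)) * complex.Im l <= 1
    & L^-1 * complex.Re l
        - (L - mu) / (L * Num.sqrt (L ^+ 2 - mu ^+ 2)) * complex.Im l <= 1]].

Definition K2_hat mu L : set R[i] :=
  [set l | mu <= complex.Re l <= L /\
    - Num.sqrt (L ^+ 2 - mu ^+ 2) <= complex.Im l
      <= Num.sqrt (L ^+ 2 - mu ^+ 2)].

(* g mu L = 1 - Theta(kappa^(-3/2)) as kappa = L / mu tends to +oo; the
   constants are uniform in (mu, L). *)
Definition one_minus_Theta (g : R -> R -> \bar R) : Prop :=
  exists c1 c2 kappa0 : R, [/\ 0 < c1, c1 <= c2 &
    forall mu L, 0 < mu -> mu < L -> kappa0 <= L / mu ->
      ((c1 * (L / mu) `^ (- (3 / 2)))%:E <= 1 - g mu L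
        <= (c2 * (L / mu) `^ (- (3 / 2)))%:E)%E].

End MinMax.

Section Polyak.
Variables (R : realType) (d : nat).
Implicit Types (F : 'rV[R]_d -> 'rV[R]_d) (x y z : 'rV[R]_d).

Definition dotp x y : R := \sum_(i < d) x 0 i * y 0 i.

(* The library norm [`|x|] on row vectors is the sup norm. *)
Definition norm2 x : R := Num.sqrt (dotp x x).

Definition strongly_monotone (mu : R) F : Prop :=
  forall z1 z2, mu * norm2 (z1 - z2) ^+ 2 <= dotp (F z1 - F z2) (z1 - z2).

Definition lipschitz2 (L : R) F : Prop :=
  forall z1 z2, norm2 (F z1 - F z2) <= L * norm2 (z1 - z2).

Definition continuously_differentiable F : Prop :=
  (forall z, differentiable F z) /\ continuous (jacobian F).

(* The t-th iterate of the pair is (z_(t-1), z_t). *)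
Definition polyak_step F (eta beta : R) (p : 'rV[R]_d * 'rV[R]_d) :=
  (p.2, (1 + beta) *: p.2 - beta *: p.1 - eta *: F p.2).

Definition polyak F (eta beta : R) (z0 : 'rV[R]_d) (t : nat) : 'rV[R]_d :=
  (iter t (polyak_step F eta beta) (z0, z0)).2.

End Polyak.

(* Main.v *)
(* The roots z and beta/z of x^2 - a x + beta have modulus at most r exactly
   when |beta| <= r^2 and a = z + beta/z lies in the ellipse with semi-axes
   r + beta/r and r - beta/r.  A negative beta elongates this ellipse in the
   imaginary direction, as the sets require.

   Upper bound: for the rectangle an explicit ellipse around the four corners
   has 1 - r of order kappa^(-3/2).  For the disk segment, beta = 0 gives at
   best r^2 = 1 - kappa^(-2), no beta >= 0 does better because of the corner
   mu + i sqrt(L^2 - mu^2), and an explicit beta < 0 does strictly better.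
   Lower bound: with e = 1 - r and delta = 1 + beta, the points mu and L force
   e kappa <= 2 delta, and the corner forces e (delta - e) <= 4 kappa^(-2);
   hence e^2 <= 16 kappa^(-3).

   Local convergence: the eigenvalues of the Jacobian at the zero of F lie in
   its numerical range, hence in the rectangle, so the spectral radius of the
   linearised iteration is at most r; a norm adapted to this linear map absorbs
   the nonlinear remainder at the price of a slightly larger rate. *)
Require Import Defs.
From HB Require Import structures.
From mathcomp Require Import all_boot all_order all_algebra.
From mathcomp Require Import all_classical all_reals all_analysis.
From mathcomp.real_closed Require Import complex.
From mathcomp Require Import ring lra.

Set Implicit Arguments.
Unset Strict Implicit.
Unset Printing Implicit Defensive.

Import Order.TTheory GRing.Theory Num.Theory.
Import numFieldNormedType.Exports.

Local Open Scope classical_set_scope.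
Local Open Scope ring_scope.

(** * Roots of a complex quadratic *)

Section Modulus.
Context {R : rcfType}.
Implicit Types z w : R[i].
Local Notation normc := Normc.normc.

Lemma normc_ge0 z : 0 <= normc z.
Proof. by case: z => x y; exact: sqrtr_ge0. Qed.

Lemma normc_sqr z : normc z ^+ 2 = complex.Re z ^+ 2 + complex.Im z ^+ 2.
Proof. by case: z => x y; rewrite sqr_sqrtr // addr_ge0 ?sqr_ge0. Qed.

Lemma normc_real (x : R) : normc x%:C%C = `|x|.
Proof. by rewrite /= expr0n addr0 sqrtr_sqr. Qed.

Lemma normc_le z (r : R) : 0 <= r ->
  (normc z <= r) = (complex.Re z ^+ 2 + complex.Im z ^+ 2 <= r ^+ 2).
Proof. by move=> r0; rewrite -normc_sqr ler_sqr // nnegrE normc_ge0. Qed.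

Lemma normc_dist z w : normc z - normc w <= normc (z - w).
Proof. by rewrite lerBlDr; have := le_normcD (z - w) w; rewrite subrK. Qed.

End Modulus.

Section QuadraticRoots.
Context {R : rcfType}.
Implicit Types (a b z : R[i]) (r : R).
Local Notation normc := Normc.normc.

(** Here [a] is the trace and [b] the determinant of the iteration matrix. Quantifying over roots
    keeps the supremum in [spectral_radius] out of the estimates. *)
Definition roots_le a b r : Prop :=
  forall z, z ^+ 2 - a * z + b = 0 -> normc z <= r.

Lemma quadratic_split a b :
  exists z1 z2, a = z1 + z2 /\ b = z1 * z2.
Proof.
pose s := sqrtc (a ^+ 2 - 4 * b).
have ss : s ^+ 2 = a ^+ 2 - 4 * b by rewrite sqr_sqrtc.
exists ((a + s) / 2), ((a - s) / 2); split; first by field.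
have -> : (a + s) / 2 * ((a - s) / 2) = (a ^+ 2 - s ^+ 2) / 4 by field.
by rewrite ss; field.
Qed.

Lemma roots_le_split r z1 z2 :
  roots_le (z1 + z2) (z1 * z2) r <-> normc z1 <= r /\ normc z2 <= r.
Proof.
have fac z : z ^+ 2 - (z1 + z2) * z + z1 * z2 = (z - z1) * (z - z2) by ring.
split=> [h|[h1 h2] z].
  by split; apply: h; rewrite fac subrr ?mul0r ?mulr0.
by rewrite fac => /eqP; rewrite mulf_eq0 !subr_eq0 => /orP[] /eqP ->.
Qed.

Lemma roots_le_mono a b r r' : r <= r' -> roots_le a b r -> roots_le a b r'.
Proof. by move=> rr' h z /h /le_trans; apply. Qed.

(* For [|z| > r] the value of the polynomial at [z] has modulus at least
   [(|z| - r)^2], so a root of the limit polynomial cannot lie there. *)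
Lemma roots_le_closed a b r :
  (forall e, 0 < e -> exists a' b',
     [/\ normc (a - a') <= e, normc (b - b') <= e & roots_le a' b' (r + e)]) ->
  roots_le a b r.
Proof.
move=> H z hz; rewrite leNgt; apply/negP => rz.
pose m := normc z; pose g := (m - r) / 2.
have g0 : 0 < g by rewrite /g /m; lra.
have m0 : 0 <= m by exact: normc_ge0.
(* [e <= g] keeps [z] at distance at least [g] from both perturbed roots; the second bound makes the
   change of the polynomial at [z], at most [e (m + 1)], smaller than [g^2]. *)
pose e := Num.min g (g ^+ 2 / (2 * (m + 1))).
have e0 : 0 < e by rewrite lt_min g0 divr_gt0 ?exprn_gt0 //; lra.
have eg : e <= g by rewrite /e ge_min lexx.
have eg2 : e * (m + 1) < g ^+ 2.
  have : e <= g ^+ 2 / (2 * (m + 1)) by rewrite /e ge_min lexx orbT.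
  rewrite ler_pdivlMr; last lra.
  have : 0 < g ^+ 2 by rewrite exprn_gt0.
  nra.
have [a' [b' [ha hb]]] := H e e0.
have [z1 [z2 [ea eb]]] := quadratic_split a' b'.
rewrite {}ea {}eb in ha hb *; move=> /roots_le_split [h1 h2].
have E : (z - z1) * (z - z2) = (a - (z1 + z2)) * z - (b - z1 * z2).
  have -> : (z - z1) * (z - z2)
     = (z ^+ 2 - a * z + b) + ((a - (z1 + z2)) * z - (b - z1 * z2)) by ring.
  by rewrite hz add0r.
have lo : g ^+ 2 <= normc ((z - z1) * (z - z2)).
  rewrite Normc.normcM expr2.
  have gz zi : normc zi <= r + e -> g <= normc (z - zi).
    by move=> hi; have := normc_dist z zi; rewrite -/m; rewrite /g in eg *; lra.
  by apply: ler_pM; rewrite ?gz // ltW.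
have hi : normc ((z - z1) * (z - z2)) <= e * (m + 1).
  rewrite E; apply: le_trans (le_normcD _ _) _.
  by rewrite normcN Normc.normcM -/m mulrDr mulr1 lerD // ler_wpM2r.
by have := le_lt_trans (le_trans lo hi) eg2; rewrite ltxx.
Qed.

Lemma roots_le_prod a b r : roots_le a b r -> normc b <= r ^+ 2.
Proof.
have [z1 [z2 [-> ->]]] := quadratic_split a b.
move=> /roots_le_split [h1 h2].
by rewrite Normc.normcM expr2 ler_pM ?normc_ge0.
Qed.

Lemma roots_le_sum a b r : roots_le a b r -> normc a <= r *+ 2.
Proof.
have [z1 [z2 [-> ->]]] := quadratic_split a b.
move=> /roots_le_split [h1 h2].
by rewrite mulr2n (le_trans (le_normcD _ _)) // lerD.
Qed.

Lemma roots_le_ge0 a b r : roots_le a b r -> 0 <= r.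
Proof.
have [z1 [z2 [-> ->]]] := quadratic_split a b.
by move=> /roots_le_split [h1 _]; apply: le_trans h1; exact: normc_ge0.
Qed.

(** A negative value of the polynomial at [r] would put a real root beyond [r]. A negative trace is
    reduced to a positive one by [z -> -z]. *)
Lemma roots_le_real (a b r : R) : roots_le a%:C%C b%:C%C r ->
  `|a| * r <= r ^+ 2 + b.
Proof.
have pos (c : R) : roots_le c%:C%C b%:C%C r -> c * r <= r ^+ 2 + b.
  move=> h; rewrite leNgt; apply/negP => lt.
  pose s := Num.sqrt (c ^+ 2 - 4 * b).
  have D0 : 0 < c ^+ 2 - 4 * b by have := sqr_ge0 (c - 2 * r); move: lt; nra.
  have s2 : s ^+ 2 = c ^+ 2 - 4 * b by rewrite sqr_sqrtr // ltW.
  have s0 : 0 <= s := sqrtr_ge0 _.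
  have : normc ((c + s) / 2)%:C%C <= r.
    apply: h; rewrite -!(rmorphM, rmorphXn, rmorphB, rmorphD) /=.
    have -> : ((c + s) / 2) ^+ 2 - c * ((c + s) / 2) + b
       = (s ^+ 2 - (c ^+ 2 - 4 * b)) / 4 by field.
    by rewrite s2 subrr mul0r.
  rewrite normc_real => /(le_trans (ler_norm _)) le.
  nra.
move=> h; case: (ger0P a) => _; first exact: pos.
apply: pos => z hz; have := h (- z); rewrite normcN; apply.
by rewrite sqrrN -hz !rmorphN /=; ring.
Qed.

(* Writing the root as [z = x + iy], [|z| = m], one has
   [a = z + b / z = x (1 + b/m^2) + i y (1 - b/m^2)]. *)
Lemma root_coordinates (p q b : R) (z : R[i]) :
  z ^+ 2 - (p +i* q)%C * z + b%:C%C = 0 ->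
  let m2 := normc z ^+ 2 in
  p * m2 = complex.Re z * (m2 + b) /\ q * m2 = complex.Im z * (m2 - b).
Proof.
move=> hz m2; have := normc_sqr z; rewrite -/m2.
case: z @m2 hz => x y m2 hz /= m2E.
have [e1 e2] : x * x - y * y - (p * x - q * y) + b = 0 /\
     x * y + y * x - (p * y + q * x) = 0.
  move/eqP: hz; rewrite expr2 eq_complex /= => /andP[/eqP e1 /eqP e2]; split.
    by rewrite -[RHS]e1; ring.
  by rewrite -[RHS]e2; ring.
rewrite m2E; split.
  have: x * (x * x - y * y - (p * x - q * y) + b)
    + y * (x * y + y * x - (p * y + q * x)) = 0 by rewrite e1 e2; ring.
  nra.
have: - y * (x * x - y * y - (p * x - q * y) + b)
    + x * (x * y + y * x - (p * y + q * x)) = 0 by rewrite e1 e2; ring.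
nra.
Qed.

(* The set of the values [z + b / z], [|z| = r], is an ellipse with semi-axes
   [r + b/r] and [r - b/r]. *)
Lemma ellipse_roots_le (p q b r : R) : 0 < r -> `|b| < r ^+ 2 ->
  r ^+ 2 * (p ^+ 2 * (r ^+ 2 - b) ^+ 2 + q ^+ 2 * (r ^+ 2 + b) ^+ 2)
    <= (r ^+ 2 + b) ^+ 2 * (r ^+ 2 - b) ^+ 2 ->
  roots_le (p +i* q)%C b%:C%C r.
Proof.
move=> r0; rewrite ltr_norml => /andP[b1 b2] h z hz.
rewrite leNgt; apply/negP => rm.
have [] := root_coordinates hz; have := normc_sqr z.
set m := normc z in rm *; set x := complex.Re z; set y := complex.Im z.
set A := r ^+ 2 + b in h *; set B := r ^+ 2 - b in h *.
move=> m2E pE qE.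
have A0 : 0 < A by rewrite /A; lra.
have B0 : 0 < B by rewrite /B; lra.
have mr : r ^+ 2 < m * r by rewrite expr2 ltr_pM2r.
have m0 : 0 < m by lra.
(* Since [|b| < r^2], both semi-axes grow strictly from radius [r] to radius [m]. *)
have u0 : 0 < ((m ^+ 2 + b) * r) ^+ 2 - (A * m) ^+ 2.
  rewrite subr_gt0 ltr_sqr ?nnegrE; last 2 first.
  - by rewrite mulr_ge0 ?ltW // mulr_gt0.
  - by rewrite mulr_ge0 ?(ltW r0) //; nra.
  rewrite -subr_gt0.
  have -> : (m ^+ 2 + b) * r - A * m = (m - r) * (m * r - b) by rewrite /A; ring.
  by rewrite mulr_gt0 //; lra.
have v0 : 0 < ((m ^+ 2 - b) * r) ^+ 2 - (B * m) ^+ 2.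
  rewrite subr_gt0 ltr_sqr ?nnegrE; last 2 first.
  - by rewrite mulr_ge0 ?ltW // mulr_gt0.
  - by rewrite mulr_ge0 ?(ltW r0) //; nra.
  rewrite -subr_gt0.
  have -> : (m ^+ 2 - b) * r - B * m = (m - r) * (m * r + b) by rewrite /B; ring.
  by rewrite mulr_gt0 //; lra.
set u := _ - _ in u0; set v := _ - _ in v0.
(* In the coordinates of the root, the ellipse inequality times [m^4] says that a positive definite
   form in [(x, y)] is nonpositive, although the root is not zero. *)
have E : (x * B) ^+ 2 * u + (y * A) ^+ 2 * v =
  (m ^+ 2) ^+ 2 * (r ^+ 2 * (p ^+ 2 * B ^+ 2 + q ^+ 2 * A ^+ 2)
     - A ^+ 2 * B ^+ 2).
  transitivity (r ^+ 2 * ((p * m ^+ 2) ^+ 2 * B ^+ 2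
      + (q * m ^+ 2) ^+ 2 * A ^+ 2)
      - A ^+ 2 * B ^+ 2 * m ^+ 2 * (x ^+ 2 + y ^+ 2)); last by rewrite -m2E; ring.
  by rewrite pE qE /u /v; ring.
have le0 : (x * B) ^+ 2 * u + (y * A) ^+ 2 * v <= 0.
  by rewrite E pmulr_rle0 ?exprn_gt0 // subr_le0.
have [xn0|x0] := eqVneq x 0; last first.
  have : 0 < (x * B) ^+ 2 * u.
    by rewrite mulr_gt0 // exprn_even_gt0 //= mulf_neq0 // gt_eqF.
  have : 0 <= (y * A) ^+ 2 * v by rewrite mulr_ge0 ?sqr_ge0 // ltW.
  lra.
have yn0 : y != 0.
  apply/eqP => y0; move: m2E; rewrite xn0 y0 expr0n addr0 => /eqP.
  by rewrite expf_eq0 /= gt_eqF.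
have : 0 < (y * A) ^+ 2 * v.
  by rewrite mulr_gt0 // exprn_even_gt0 //= mulf_neq0 // gt_eqF.
have : 0 <= (x * B) ^+ 2 * u by rewrite mulr_ge0 ?sqr_ge0 // ltW.
lra.
Qed.

(** Necessity, tested with the linear form [p t - q]: by Cauchy-Schwarz its square on the ellipse is
    at most [(r + b/r)^2 t^2 + (r - b/r)^2]. Free of divisions, this also covers degenerate
    ellipses. *)
Lemma roots_le_ellipse (p q b r t : R) :
  roots_le (p +i* q)%C b%:C%C r ->
  (p * t - q) ^+ 2 * r ^+ 2
    <= (r ^+ 2 + b) ^+ 2 * t ^+ 2 + (r ^+ 2 - b) ^+ 2.
Proof.
move=> h.
have rhs0 (c : R) : 0 <= (c + b) ^+ 2 * t ^+ 2 + (c - b) ^+ 2.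
  by rewrite addr_ge0 ?sqr_ge0 // -exprMn sqr_ge0.
(* The root of larger modulus [m] satisfies [|b| <= m^2], which makes the semi-axes monotone between
   [m] and [r]. *)
have [z [hz [bz az]]] : exists z, z ^+ 2 - (p +i* q)%C * z + b%:C%C = 0
    /\ `|b| <= normc z ^+ 2 /\ normc (p +i* q)%C <= normc z *+ 2.
  have [z1 [z2 [e1 e2]]] := quadratic_split (p +i* q)%C b%:C%C.
  have fac z : z ^+ 2 - (z1 + z2) * z + z1 * z2 = (z - z1) * (z - z2) by ring.
  rewrite e1 -normc_real e2 Normc.normcM.
  have [l|l] := leP (normc z1) (normc z2).
    exists z2; rewrite fac subrr mulr0 expr2 ler_wpM2r ?normc_ge0 //.
    by rewrite mulr2n (le_trans (le_normcD _ _)) // lerD.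
  exists z1; rewrite fac subrr mul0r expr2 ler_wpM2l ?normc_ge0 ?(ltW l) //.
  by rewrite mulr2n (le_trans (le_normcD _ _)) // lerD // ltW.
have [] := root_coordinates hz; have := normc_sqr z; have := h z hz.
move: bz; rewrite ler_norml.
set m := normc z; set x := complex.Re z; set y := complex.Im z.
move=> /andP[b1 b2] mr m2E pE qE.
have m0 : 0 <= m by exact: normc_ge0.
have [mz|mn0] := eqVneq m 0.
  have b0 : b = 0 by rewrite mz expr0n /= in b1 b2; lra.
  have /Normc.eq0_normc[-> ->] : normc (p +i* q)%C = 0.
    by apply/eqP; rewrite eq_le normc_ge0 (le_trans az) // -/m mz mul0rn.
  by rewrite mul0r subr0 expr0n mul0r.
have m20 : 0 < m ^+ 2 by rewrite exprn_gt0 // lt_def mn0.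
have mr2 : m ^+ 2 <= r ^+ 2 by rewrite ler_sqr ?nnegrE //; lra.
have key1 : (p * t - q) ^+ 2 * m ^+ 2
    <= (m ^+ 2 + b) ^+ 2 * t ^+ 2 + (m ^+ 2 - b) ^+ 2.
  rewrite -(ler_pM2r m20) -subr_ge0.
  have -> : ((m ^+ 2 + b) ^+ 2 * t ^+ 2 + (m ^+ 2 - b) ^+ 2) * m ^+ 2
     - (p * t - q) ^+ 2 * m ^+ 2 * m ^+ 2
     = ((m ^+ 2 + b) * t * y + (m ^+ 2 - b) * x) ^+ 2.
    have -> : (p * t - q) ^+ 2 * m ^+ 2 * m ^+ 2
      = (p * m ^+ 2 * t - q * m ^+ 2) ^+ 2 by ring.
    by rewrite pE qE {3}m2E; ring.
  exact: sqr_ge0.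
have mono (c : R) : c ^+ 2 = b ^+ 2 ->
    (m ^+ 2 + c) ^+ 2 * r ^+ 2 <= (r ^+ 2 + c) ^+ 2 * m ^+ 2.
  move=> cb; rewrite -subr_ge0.
  have -> : (r ^+ 2 + c) ^+ 2 * m ^+ 2 - (m ^+ 2 + c) ^+ 2 * r ^+ 2
     = (r ^+ 2 - m ^+ 2) * (r ^+ 2 * m ^+ 2 - c ^+ 2) by ring.
  rewrite cb mulr_ge0 ?subr_ge0 //.
  have : m ^+ 2 * m ^+ 2 <= r ^+ 2 * m ^+ 2 by rewrite ler_wpM2r // ltW.
  have : 0 <= (m ^+ 2 - b) * (m ^+ 2 + b) by apply: mulr_ge0; lra.
  nra.
rewrite -(ler_pM2r m20).
have l1 := mono b erefl; have l2 := mono (- b) (sqrrN b).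
have l3 : (p * t - q) ^+ 2 * m ^+ 2 * r ^+ 2
   <= ((m ^+ 2 + b) ^+ 2 * t ^+ 2 + (m ^+ 2 - b) ^+ 2) * r ^+ 2.
  by rewrite ler_wpM2r ?sqr_ge0.
have l4 := ler_wpM2r (sqr_ge0 t) l1.
nra.
Qed.

End QuadraticRoots.

(** * Worst-case radius and existence of an optimum *)

Section RhoHat.
Context {R : realType}.
Implicit Types (K : set R[i]) (eta beta r : R) (l z : R[i]).
Local Notation normc := Normc.normc.

Lemma mul_row_momentum_mx eta beta l (x y : R[i]) :
  row_mx x%:M y%:M *m (momentum_mx eta beta l : 'M[R[i]]_(1 + 1))
  = row_mx (x * (1 + beta%:C%C - eta%:C%C * l) + y)%:M (- (x * beta%:C%C))%:M.
Proof.
rewrite /momentum_mx; etransitivity; first exact: mul_row_block.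
by rewrite mulmx0 addr0 mulmx1 -!scalar_mxM -raddfD mulrN.
Qed.

(** An eigenvector is a row, here a multiple of [(1, z - a)] with [a] the trace; its second
    coordinate yields the characteristic equation. *)
Lemma eigenvalue_momentum_mx eta beta l z :
  eigenvalue (momentum_mx eta beta l) z <->
  z ^+ 2 - (1 + beta%:C%C - eta%:C%C * l) * z + beta%:C%C = 0.
Proof.
have scale_row (x y : R[i]) : z *: row_mx x%:M y%:M
    = row_mx (z * x)%:M (z * y)%:M :> 'M[R[i]]_(1, 1 + 1).
  by rewrite scale_row_mx !scale_scalar_mx.
set a := 1 + _ - _; split.
  move=> /eigenvalueP [v].
  rewrite -(@hsubmxK _ 1 1 1 v) [lsubmx _]mx11_scalar [rsubmx _]mx11_scalar.
  move: (lsubmx _ 0 0) (rsubmx _ 0 0) => x y.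
  rewrite mul_row_momentum_mx -/a scale_row => e; have [] := @eq_row_mx R[i] 1 1 1 _ _ _ _ e.
  move=> /matrixP/(_ 0 0); rewrite !mxE eqxx !mulr1n => e1.
  move=> /matrixP/(_ 0 0); rewrite !mxE eqxx !mulr1n => e2 v0.
  have yE : y = (z - a) * x by rewrite mulrBl -e1; ring.
  have x0 : x != 0.
    apply: contraNneq v0 => x0.
    by rewrite yE x0 mulr0 raddf0 row_mx0.
  apply: (mulIf x0); rewrite mul0r.
  have -> : (z ^+ 2 - a * z + beta%:C%C) * x
     = z * ((z - a) * x) - - (x * beta%:C%C) by ring.
  by rewrite -yE e2 subrr.
move=> e; apply/eigenvalueP; exists (row_mx 1%:M (z - a)%:M); last first.
  apply/eqP => /matrixP /(_ 0 (@lshift 1 1 0)).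
  by rewrite (@row_mxEl _ 1 1 1) !mxE eqxx => /eqP; rewrite oner_eq0.
rewrite mul_row_momentum_mx -/a scale_row; congr (row_mx _%:M _%:M); first by ring.
apply/eqP; rewrite -subr_eq0 -oppr_eq0 -e.
by apply/eqP; ring.
Qed.

(** The quadratic splits, so the set of moduli is nonempty and bounded, and [sup] is a true least
    upper bound rather than a default value. *)
Lemma spectral_radius_le eta beta l r :
  spectral_radius (momentum_mx eta beta l) <= r <->
  roots_le (1 + beta%:C%C - eta%:C%C * l) beta%:C%C r.
Proof.
rewrite /spectral_radius; set S := [set _ | _ in _]; set a := 1 + _ - _.
have [z1 [z2 [ea eb]]] := quadratic_split a beta%:C%C.
have fac z : z ^+ 2 - (z1 + z2) * z + z1 * z2 = (z - z1) * (z - z2) by ring.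
have S0 : S !=set0.
  exists (normc z1); exists z1 => //; apply/eigenvalue_momentum_mx.
  by rewrite -/a ea eb fac subrr mul0r.
have Sub : has_ubound S.
  exists (Num.max (normc z1) (normc z2)) => _ [z /eigenvalue_momentum_mx + <-].
  rewrite -/a ea eb => hz; move: z hz.
  by apply/roots_le_split; rewrite !le_max !lexx orbT.
split=> [h z hz|h].
  apply: le_trans h; apply: ub_le_sup => //; exists z => //.
  exact/eigenvalue_momentum_mx.
by apply: ge_sup => // _ [z /eigenvalue_momentum_mx hz <-]; exact: h.
Qed.

(** The sublevel sets of [worst_radius], expressed without extended reals. *)
Definition feasible K eta beta r : Prop :=
  forall l, K l -> roots_le (1 + beta%:C%C - eta%:C%C * l) beta%:C%C r.

Lemma worst_radius_le K eta beta r :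
  (worst_radius K eta beta <= r%:E)%E <-> feasible K eta beta r.
Proof.
split=> [h l Kl|h].
  apply/spectral_radius_le; rewrite -lee_fin; apply: le_trans h.
  by apply: ereal_sup_ubound; exists l.
apply: ge_ereal_sup => _ [l Kl <-]; rewrite lee_fin.
by apply/spectral_radius_le; exact: h.
Qed.

Lemma rho_hat_le_worst K eta beta : (rho_hat K <= worst_radius K eta beta)%E.
Proof. by apply: ereal_inf_lbound; exists (eta, beta). Qed.

Lemma feasible_rho_hat K eta beta r :
  feasible K eta beta r -> (rho_hat K <= r%:E)%E.
Proof.
by move=> /worst_radius_le; apply: le_trans; exact: rho_hat_le_worst.
Qed.

Lemma le_rho_hat K (x : R) : K !=set0 ->
  (forall eta beta r, feasible K eta beta r -> x <= r) ->
  (x%:E <= rho_hat K)%E.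
Proof.
move=> [l0 Kl0] h; apply: le_ereal_inf_tmp => _ [[eta beta] _ <-] /=.
case E : (worst_radius K eta beta) => [r| |].
- by rewrite lee_fin; apply: (h eta beta); apply/worst_radius_le; rewrite E.
- by rewrite leey.
(* A worst radius of -oo would make every real feasible, [x - 1] included. *)
- have : (worst_radius K eta beta <= (x - 1)%R%:E)%E by rewrite E leNye.
  by move=> /worst_radius_le /h; rewrite lerBrDl gerDr ler10.
Qed.

Lemma rho_hat_fin K : K !=set0 -> exists2 r : R, 0 <= r <= 1 & rho_hat K = r%:E.
Proof.
move=> K0.
have lo : (0%:E <= rho_hat K)%E.
  apply: le_rho_hat => // eta beta r h; have [l Kl] := K0.
  exact: roots_le_ge0 (h l Kl).
have hi : (rho_hat K <= 1%:E)%E.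
  (* With [eta = beta = 0] the roots are 0 and 1 for every [l]. *)
  apply: (@feasible_rho_hat _ 0 0) => l _ z; rewrite mul0r subr0 !addr0 mul1r.
  move=> /eqP; rewrite expr2 -[X in _ - X]mul1r -mulrBl mulf_eq0 subr_eq0.
  by move=> /orP[] /eqP ->; rewrite ?Normc.normc1 ?Normc.normc0 ?ler01.
move: lo hi; case: (rho_hat K) => [r| |] //.
by rewrite !lee_fin => lo hi; exists r => //; rewrite lo.
Qed.

(** Near-optimal pairs stay in a compact box: the product of the roots bounds [beta], then their sum
    bounds [eta l0], hence [eta] as [l0 != 0]. A cluster point is optimal because root bounds
    survive limits for each [l]. *)
Lemma exists_optimal_pair K : (exists2 l, K l & l != 0) ->
  exists eta beta, optimal_pair K eta beta.
Proof.
move=> [l0 Kl0 l00].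
have [|r /andP[r0 r1] rE] := @rho_hat_fin K; first by exists l0.
have near n : exists p : R * R, feasible K p.1 p.2 (r + n.+1%:R^-1).
  have : (rho_hat K < (r + n.+1%:R^-1)%R%:E)%E by rewrite rE lte_fin ltrDl.
  move=> /ereal_inf_lt [_ [p _ <-]] /ltW ?.
  by exists p; apply/worst_radius_le.
have [p hp] := choice near.
have n1 n : (n.+1%:R^-1 : R) <= 1 by rewrite invf_le1 ?ler1n.
have m0 : 0 < normc l0.
  by rewrite lt_def normc_ge0 andbT; apply: contra_neq l00; exact: Normc.eq0_normc.
(* With roots of modulus at most 2, [|beta| <= 4] and the trace is at most 4 in modulus, so
   [|eta l0| <= 1 + 4 + 4]. *)
pose B := 9 / normc l0.
pose box : set (R * R) := `[- B, B] `*` `[- 4, 4].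
have box_compact : compact box by apply: compact_setX; exact: segment_compact.
have pbox n : box (p n).
  have r2 : r + n.+1%:R^-1 <= 2 by rewrite -[2]/(1 + 1) lerD.
  move: (r + _) (hp n l0 Kl0) r2 => rn h r2.
  have rn0 := roots_le_ge0 h.
  have b4 : `|(p n).2| <= 4.
    rewrite -normc_real; apply: le_trans (roots_le_prod h) _.
    by rewrite (_ : 4 = 2 ^+ 2); [rewrite ler_sqr ?nnegrE | ring].
  have s4 := roots_le_sum h.
  split=> /=; rewrite in_itv /= -ler_norml // /B ler_pdivlMr //.
  rewrite -normc_real -Normc.normcM.
  have -> : (p n).1%:C%C * l0 = 1 + (p n).2%:C%C
     - (1 + (p n).2%:C%C - (p n).1%:C%C * l0) by ring.
  apply: le_trans (le_normcD _ _) _; rewrite normcN.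
  have := le_normcD 1 (p n).2%:C%C; rewrite mulr2n in s4; rewrite Normc.normc1 normc_real.
  lra.
have [] := box_compact (p @ \oo) _ _.
  by exists 0%N => // n _; exact: pbox.
move=> [eta beta] [_ cl]; exists eta, beta.
apply/eqP; rewrite eq_le rho_hat_le_worst andbT rE; apply/worst_radius_le.
move=> l Kl; apply: roots_le_closed => e e0.
(* Moving both parameters by at most [d] moves the trace by at most [d + d |l| = e]. *)
pose d := e / (normc l + 1).
have m1 : 0 < normc l + 1 by have := normc_ge0 l; lra.
have d0 : 0 < d by rewrite divr_gt0.
have [N _ HN] := near_infty_natSinv_lt (PosNum e0).
have [||q [[n nN <-]]] := cl [set p n | n in [set n | (N <= n)%N]]
  (ball eta d `*` ball beta d).
- by exists N => // n nN; exists n.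
- by exists (ball eta d, ball beta d) => //; split; exact: nbhsx_ballx.
move=> [/= h1 h2]; exists (1 + (p n).2%:C%C - (p n).1%:C%C * l), (p n).2%:C%C.
split.
- have -> : 1 + beta%:C%C - eta%:C%C * l
       - (1 + (p n).2%:C%C - (p n).1%:C%C * l)
     = (beta - (p n).2)%:C%C - (eta - (p n).1)%:C%C * l.
    by rewrite !rmorphB; ring.
  apply: le_trans (le_normcD _ _) _; rewrite normcN Normc.normcM !normc_real.
  have -> : e = d + d * normc l by rewrite /d; field; rewrite gt_eqF.
  by rewrite lerD ?ler_wpM2r ?normc_ge0 // ltW.
- rewrite -rmorphB normc_real; apply: le_trans (ltW h2) _.
  by rewrite /d ler_pdivrMr // ler_peMr ?(ltW e0) // lerDr normc_ge0.
apply: roots_le_mono (hp n l Kl); rewrite lerD2l ltW //; exact: HN.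
Qed.

End RhoHat.

(** * Bounds for the three regions *)

Section Geometry.
Context {R : realType}.
Implicit Types (K : set R[i]) (mu L eta beta r : R) (l z : R[i]).
Local Notation normc := Normc.normc.

Lemma momentum_trace eta beta (x y : R) :
  1 + beta%:C%C - eta%:C%C * (x +i* y)%C
  = ((1 + beta - eta * x) +i* (- (eta * y)))%C.
Proof. by apply/eqP; rewrite eq_complex /=; apply/andP; split; apply/eqP; ring. Qed.

(** Root bounds pass to the closure of [K], the trace being Lipschitz in [l] with constant
    [|eta|]. *)
Lemma feasible_closure K eta beta r l : feasible K eta beta r ->
  (forall e, 0 < e -> exists2 l', K l' & normc (l - l') <= e) ->
  roots_le (1 + beta%:C%C - eta%:C%C * l) beta%:C%C r.
Proof.
move=> h near; apply: roots_le_closed => e e0.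
have n0 : 0 < `|eta| + 1 by rewrite ltr_wpDl.
have [l' Kl' ll'] := near (e / (`|eta| + 1)) (divr_gt0 e0 n0).
exists (1 + beta%:C%C - eta%:C%C * l'), beta%:C%C; split.
- have -> : 1 + beta%:C%C - eta%:C%C * l - (1 + beta%:C%C - eta%:C%C * l')
    = - (eta%:C%C * (l - l')) by ring.
  rewrite normcN Normc.normcM normc_real.
  rewrite ler_pdivlMr // in ll'; apply: le_trans ll'.
  by rewrite mulrC ler_wpM2l ?normc_ge0 // lerDl.
- by rewrite subrr Normc.normc0 ltW.
- by apply: roots_le_mono (h l' Kl'); rewrite lerDl ltW.
Qed.

(** The open set [K_hat] misses [mu], [L] and the corner, where the lower bounds are read off.
    Points of the closed disk segment are approached along the line to the interior point
    [(mu + L) / 2]. *)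
Lemma feasible_K_hat mu L eta beta r l : 0 < mu -> mu < L ->
  feasible (K_hat mu L) eta beta r -> mu <= complex.Re l -> normc l <= L ->
  roots_le (1 + beta%:C%C - eta%:C%C * l) beta%:C%C r.
Proof.
move=> mu0 muL h lx lL; apply: feasible_closure h _ => e e0.
pose l0 : R[i] := ((mu + L) / 2)%:C%C.
pose D := normc (l - l0); have D0 : 0 <= D := normc_ge0 _.
pose t := e / (e + D + 1); have d0 : 0 < e + D + 1 by lra.
have t0 : 0 < t by rewrite divr_gt0.
have t1 : t < 1 by rewrite ltr_pdivrMr // mul1r; lra.
exists (l + t%:C%C * (l0 - l)); last first.
  rewrite opprD addNKr -mulrN opprB Normc.normcM normc_real gtr0_norm // -/D.
  rewrite /t mulrAC ler_pdivrMr // ler_pM2l //; lra.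
split; last first.
  rewrite raddfD /=.
  have -> : complex.Re (t%:C%C * (l0 - l))
     = t * ((mu + L) / 2 - complex.Re l).
    by case: (l) => x y /=; ring.
  have : 0 <= (1 - t) * (complex.Re l - mu) by apply: mulr_ge0; lra.
  have : 0 < t * ((L - mu) / 2) by apply: mulr_gt0; lra.
  nra.
have -> : l + t%:C%C * (l0 - l) = (1 - t)%:C%C * l + t%:C%C * l0.
  by rewrite rmorphB /=; ring.
apply: le_lt_trans (le_normcD _ _) _.
rewrite !Normc.normcM !normc_real !ger0_norm; [|lra..].
have : (1 - t) * normc l <= (1 - t) * L by rewrite ler_pM2l //; lra.
have : 0 < t * ((L - mu) / 2) by apply: mulr_gt0; lra.
nra.
Qed.

(** The slope [t = s / mu] eliminates [eta]: [p t - q = (1 + beta) s / mu]. The rest is the identity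
    [(1 + beta)^2 r^2 - (r^2 + beta)^2 = (1 - r^2) (r^2 - beta^2)]. *)
Lemma vertex_bound mu s eta beta r : 0 < mu ->
  roots_le (1 + beta%:C%C - eta%:C%C * (mu +i* s)%C) beta%:C%C r ->
  (1 - r ^+ 2) * (r ^+ 2 - beta ^+ 2) * s ^+ 2
    <= (r ^+ 2 - beta) ^+ 2 * mu ^+ 2.
Proof.
move=> mu0; rewrite momentum_trace => /(@roots_le_ellipse _ _ _ _ _ (s / mu)) h.
have mun0 : mu != 0 by rewrite gt_eqF.
move: h; rewrite -(ler_pM2r (exprn_gt0 2 mu0)) -subr_ge0 => h.
rewrite -subr_ge0; apply: le_trans h _; rewrite le_eqVlt; apply/orP; left.
by apply/eqP; field.
Qed.

Lemma real_bound (x : R) eta beta r :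
  roots_le (1 + beta%:C%C - eta%:C%C * x%:C%C) beta%:C%C r ->
  `|1 + beta - eta * x| * r <= r ^+ 2 + beta.
Proof.
move=> h; apply: roots_le_real.
by rewrite rmorphB rmorphM rmorphD rmorph1.
Qed.

(** For [0 <= beta <= r^2 < r] one has [(r^2 - beta)^2 <= r^2 (r^2 - beta^2)], with equality at
    [beta = 0]; the factor [r^2 - beta^2] then cancels in [vertex_bound]. *)
Lemma nonneg_momentum_bound mu L eta beta r : 0 < mu -> mu < L ->
  0 <= beta -> 0 < r < 1 ->
  roots_le (1 + beta%:C%C
    - eta%:C%C * (mu +i* Num.sqrt (L ^+ 2 - mu ^+ 2))%C) beta%:C%C r ->
  L ^+ 2 - mu ^+ 2 <= r ^+ 2 * L ^+ 2.
Proof.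
move=> mu0 muL b0 /andP[r0 r1] h.
have := roots_le_prod h; rewrite normc_real ger0_norm // => br.
have s0 : 0 <= L ^+ 2 - mu ^+ 2 by rewrite subr_ge0 ler_sqr ?nnegrE; lra.
have := vertex_bound mu0 h; rewrite sqr_sqrtr //.
set S := L ^+ 2 - mu ^+ 2 in s0 *; move=> v.
have LE : L ^+ 2 = S + mu ^+ 2 by rewrite /S; ring.
have r2 : r ^+ 2 < r by rewrite expr2 gtr_pMr.
have b2 : beta ^+ 2 < r ^+ 2 by rewrite ltr_sqr ?nnegrE; lra.
have le1 : (r ^+ 2 - beta) ^+ 2 <= r ^+ 2 * (r ^+ 2 - beta ^+ 2).
  rewrite -subr_ge0.
  have -> : r ^+ 2 * (r ^+ 2 - beta ^+ 2) - (r ^+ 2 - beta) ^+ 2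
    = beta * ((r ^+ 2 - beta) + r ^+ 2 * (1 - beta)) by ring.
  by rewrite mulr_ge0 // addr_ge0 ?mulr_ge0 ?sqr_ge0 //; lra.
have le2 : (r ^+ 2 - beta) ^+ 2 * mu ^+ 2
   <= r ^+ 2 * (r ^+ 2 - beta ^+ 2) * mu ^+ 2 by rewrite ler_wpM2r ?sqr_ge0.
have : (1 - r ^+ 2) * S <= r ^+ 2 * mu ^+ 2.
  have p0 : 0 < r ^+ 2 - beta ^+ 2 by rewrite subr_gt0.
  by rewrite -(ler_pM2r p0); have := le_trans v le2; lra.
rewrite LE; nra.
Qed.

Lemma rate_lower_bound mu L eta beta r : 0 < mu -> 9 * mu <= L ->
  2^-1 <= r < 1 ->
  roots_le (1 + beta%:C%C - eta%:C%C * mu%:C%C) beta%:C%C r ->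
  roots_le (1 + beta%:C%C - eta%:C%C * L%:C%C) beta%:C%C r ->
  roots_le (1 + beta%:C%C
    - eta%:C%C * (mu +i* Num.sqrt (L ^+ 2 - mu ^+ 2))%C) beta%:C%C r ->
  (1 - r) ^+ 2 * L ^+ 3 <= 16 * mu ^+ 3.
Proof.
move=> mu0 muL /andP[r0 r1] hmu hL hv.
have L0 : 0 < L by lra.
have mu30 : 0 < mu ^+ 3 by rewrite exprn_gt0.
pose e := 1 - r; have e0 : 0 < e by rewrite /e; lra.
have rE : r = 1 - e by rewrite /e; ring.
rewrite -/e.
(* For [beta >= 0] the corner alone gives [e <= kappa^(-2)], which is stronger than required. *)
have [b0|b0] := leP 0 beta.
  have : L ^+ 2 - mu ^+ 2 <= r ^+ 2 * L ^+ 2.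
    by apply: nonneg_momentum_bound hv => //; lra.
  rewrite rE => h.
  have h1 : e * L ^+ 2 <= mu ^+ 2.
    have : 0 <= e * (1 - e) * L ^+ 2.
      by rewrite mulr_ge0 ?sqr_ge0 // mulr_ge0 //; lra.
    nra.
  have h2 : e * L ^+ 2 * (e * L ^+ 2) <= mu ^+ 2 * mu ^+ 2.
    by apply: ler_pM; rewrite // mulr_ge0 ?sqr_ge0 // ltW.
  rewrite -(ler_pM2r L0); have -> : e ^+ 2 * L ^+ 3 * L = e * L ^+ 2 * (e * L ^+ 2) by ring.
  apply: le_trans h2 _; have -> : mu ^+ 2 * mu ^+ 2 = mu ^+ 3 * mu by ring.
  have : mu ^+ 3 * mu <= mu ^+ 3 * L by rewrite ler_pM2l //; lra.
  have : 0 < mu ^+ 3 * L by rewrite mulr_gt0.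
  lra.
have := roots_le_prod hv; rewrite normc_real ler_norml => /andP[br _].
have s0 : 0 <= L ^+ 2 - mu ^+ 2 by rewrite subr_ge0 ler_sqr ?nnegrE; lra.
have := vertex_bound mu0 hv; rewrite sqr_sqrtr // => v.
have r2 : r ^+ 2 < r by rewrite expr2 gtr_pMr //; lra.
have rb : 0 < r - beta by lra.
have rb' : 0 <= r + beta by lra.
(* As [(r^2 - beta)^2 <= (r - beta)^2], a factor [r - beta] cancels in [vertex_bound]. *)
have e1 : e * (r + beta) * (L ^+ 2 - mu ^+ 2) <= 2 * mu ^+ 2.
  have S0 : 0 <= e * (r + beta) * (L ^+ 2 - mu ^+ 2).
    by rewrite !mulr_ge0 // ltW.
  have u : (r ^+ 2 - beta) ^+ 2 * mu ^+ 2 <= (r - beta) ^+ 2 * mu ^+ 2.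
    by rewrite ler_wpM2r ?sqr_ge0 // ler_sqr ?nnegrE //; lra.
  have {}u := le_trans v u.
  have : e * (r + beta) * (L ^+ 2 - mu ^+ 2) * (1 + r) <= (r - beta) * mu ^+ 2.
    rewrite -(ler_pM2r rb); apply: le_trans (le_trans _ u) _; last by nra.
    by rewrite le_eqVlt; apply/orP; left; apply/eqP; rewrite /e; ring.
  have : (r - beta) * mu ^+ 2 <= 2 * mu ^+ 2.
    by rewrite ler_wpM2r ?sqr_ge0 //; lra.
  nra.
have hp : 0 < 1 + beta by lra.
(* At [mu] the real bound reads [e (r - beta) <= eta mu r]; dropping [- e beta >= 0] lets [r]
   cancel. The point [L] is treated alike. *)
have e2 : e <= eta * mu.
  have := real_bound hmu; have := ler_norm (1 + beta - eta * mu) => n1.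
  move=> /(le_trans (ler_wpM2r _ n1)) n2.
  have {n2} : (1 + beta - eta * mu) * r <= r ^+ 2 + beta by apply: n2; lra.
  have : 0 <= e * (- beta) by rewrite mulr_ge0 //; lra.
  rewrite rE => A1 A2.
  have : e * r <= eta * mu * r by rewrite rE; nra.
  by rewrite ler_pM2r //; lra.
have e3 : eta * L <= 2 * (1 + beta).
  have := real_bound hL; rewrite -normrN; have := ler_norm (- (1 + beta - eta * L)) => n1.
  move=> /(le_trans (ler_wpM2r _ n1)) n2.
  have {n2} : - (1 + beta - eta * L) * r <= r ^+ 2 + beta by apply: n2; lra.
  have : 0 <= e * (- beta) by rewrite mulr_ge0 //; lra.
  rewrite rE => A1 A2.
  have : eta * L * r <= 2 * (1 + beta) * r by rewrite rE; nra.
  by rewrite ler_pM2r //; lra.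
have e4 : e * L <= 2 * (1 + beta) * mu.
  have : e * L <= eta * mu * L by rewrite ler_pM2r.
  have : eta * L * mu <= 2 * (1 + beta) * mu by rewrite ler_pM2r.
  lra.
have LL : L ^+ 2 <= 2 * (L ^+ 2 - mu ^+ 2).
  have : mu * (9 * mu) <= L * L by apply: ler_pM; lra.
  have := sqr_ge0 mu; lra.
have e5 : e * (r + beta) * L ^+ 2 <= 4 * mu ^+ 2.
  have : e * (r + beta) * L ^+ 2 <= e * (r + beta) * (2 * (L ^+ 2 - mu ^+ 2)).
    by rewrite ler_wpM2l // mulr_ge0 // ltW.
  lra.
(* Multiply [e4] by [e L^2] and split [1 + beta = (r + beta) + e]: the first part is bounded by
   [e5], the second is at most half of the left side because [2 mu <= L / 2]. *)
have e6 : e * L * (e * L ^+ 2) <= 2 * (1 + beta) * mu * (e * L ^+ 2).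
  by rewrite ler_wpM2r // mulr_ge0 ?sqr_ge0 // ltW.
have e7 : e * (r + beta) * L ^+ 2 * (2 * mu) <= 4 * mu ^+ 2 * (2 * mu).
  by rewrite ler_pM2r //; lra.
have e8 : (e * L) ^+ 2 * (2 * mu) <= (e * L) ^+ 2 * (L / 2).
  by rewrite ler_wpM2l ?sqr_ge0 //; lra.
rewrite rE in e7; nra.
Qed.

End Geometry.

(** * Explicit ellipses for the rectangle and for the disk segment *)

Section OptimalRate.
Context {R : realType}.
Implicit Types (K : set R[i]) (mu L eta beta r k kappa : R) (l z : R[i]).
Local Notation normc := Normc.normc.

(** With [beta = - r^2 th] the semi-axes are [r (1 - th)] and [r (1 + th)], so [th] fixes the shape
    of the ellipse and [r] its size. *)
Lemma ellipse_ratio_roots_le (p q th r : R) : 0 < r -> 0 <= th < 1 ->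
  p ^+ 2 * (1 + th) ^+ 2 + q ^+ 2 * (1 - th) ^+ 2
    <= r ^+ 2 * ((1 - th) * (1 + th)) ^+ 2 ->
  roots_le (p +i* q)%C (- (r ^+ 2 * th))%:C%C r.
Proof.
move=> r0 /andP[th0 th1] h; apply: ellipse_roots_le => //.
  have r20 : 0 < r ^+ 2 by rewrite exprn_gt0.
  by rewrite normrN ger0_norm; [rewrite gtr_pMr | rewrite mulr_ge0 // ltW].
have r60 : 0 <= (r ^+ 2) ^+ 3 by rewrite exprn_ge0 // sqr_ge0.
have := ler_wpM2l r60 h; nra.
Qed.

(** Real over imaginary semi-axis of the ellipse used for the rectangle, normalised so that
    [mu = 4 k^2 (L + mu)]. *)
Definition axis_ratio kappa : R := (2 * Num.sqrt (kappa + 1))^-1.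

Lemma axis_ratio_gt0 kappa : 0 < kappa -> 0 < axis_ratio kappa.
Proof. by move=> k0; rewrite invr_gt0 mulr_gt0 // sqrtr_gt0; lra. Qed.

Lemma axis_ratio_sqr kappa : 0 < kappa ->
  4 * axis_ratio kappa ^+ 2 * (kappa + 1) = 1.
Proof.
move=> k0; rewrite /axis_ratio exprVn exprMn sqr_sqrtr; last lra.
by field; rewrite gt_eqF //; lra.
Qed.

Lemma axis_ratio_lt_half kappa : 1 < kappa -> axis_ratio kappa < 2^-1.
Proof.
move=> k1; have k0 : 0 < kappa by lra.
rewrite -ltr_sqr ?nnegrE ?ltW ?axis_ratio_gt0 ?invr_gt0 //.
have := axis_ratio_sqr k0; have := axis_ratio_gt0 k0.
have : 0 < axis_ratio kappa ^+ 2 by rewrite exprn_gt0 // axis_ratio_gt0.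
nra.
Qed.

(** This is [- r^2 th] with [r^2 = 1 - 2 k^3] and [th = (1 - k) / (1 + k)], the value for which
    [(1 - th) / (1 + th) = k]. *)
Definition K2_beta kappa : R :=
  let k := axis_ratio kappa in - ((1 - 2 * k ^+ 3) * ((1 - k) / (1 + k))).

(** Chosen so that the trace vanishes at the centre [(L + mu) / 2] of the rectangle. *)
Definition K2_eta mu L : R := 2 * (1 + K2_beta (L / mu)) / (L + mu).

Lemma K2_beta_lt0 kappa : 1 < kappa -> K2_beta kappa < 0.
Proof.
move=> k1; rewrite oppr_lt0; have := axis_ratio_lt_half k1.
have := @axis_ratio_gt0 kappa; rewrite (lt_trans ltr01 k1) => /(_ isT).
set k := axis_ratio kappa => kp kh.
have : k ^+ 3 < 2^-1 ^+ 3 by rewrite ltr_pXn2r ?nnegrE //; lra.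
move=> k3; rewrite mulr_gt0 // ?divr_gt0 //; lra.
Qed.

Lemma K2_eta_gt0 mu L : 0 < mu -> mu < L -> 0 < K2_eta mu L.
Proof.
move=> mu0 muL; have k1 : 1 < L / mu by rewrite ltr_pdivlMr // mul1r.
have k0 : 0 < L / mu by lra.
rewrite divr_gt0 ?mulr_gt0 ?subr_gt0 //; last lra.
have := axis_ratio_lt_half k1; have := axis_ratio_gt0 k0.
set k := axis_ratio _ => kp kh.
have : k ^+ 3 < 2^-1 ^+ 3 by rewrite ltr_pXn2r ?nnegrE //; lra.
have k3 : 0 < k ^+ 3 by rewrite exprn_gt0.
move=> k3'; apply: mulr_ilt1; rewrite ?divr_ge0 ?ltr_pdivrMr ?subr_ge0 //; lra.
Qed.

(** The ellipse form is even in [S - 2 x] and in [y], so it is estimated by its value at a corner.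
    With [mu = 4 k^2 S] this leaves [(1 + k^2)^2 (1 - 8 k^2) (1 - 4 k^2) <= 1 - 2 k^3]. *)
Lemma feasible_K2 mu L : 0 < mu -> mu < L ->
  feasible (K2_hat mu L) (K2_eta mu L) (K2_beta (L / mu))
    (Num.sqrt (1 - 2 * axis_ratio (L / mu) ^+ 3)).
Proof.
move=> mu0 muL [x y] [/= /andP[x1 x2] y12].
have kap : 1 < L / mu by rewrite ltr_pdivlMr // mul1r.
have kap0 : 0 < L / mu by lra.
rewrite momentum_trace /K2_eta.
have kh := axis_ratio_lt_half kap; have k0 := axis_ratio_gt0 kap0.
have ksq := axis_ratio_sqr kap0.
rewrite /K2_beta; set k := axis_ratio _ in kh k0 ksq *.
set S := L + mu; have S0 : 0 < S by rewrite /S; lra.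
have muE : mu = 4 * k ^+ 2 * S.
  have -> : S = (L / mu + 1) * mu by rewrite /S; field; rewrite gt_eqF.
  by rewrite mulrA ksq mul1r.
have k3 : k ^+ 3 < 2^-1 ^+ 3 by rewrite ltr_pXn2r ?nnegrE //; lra.
have k30 : 0 < k ^+ 3 by rewrite exprn_gt0.
have k20 : 0 < k ^+ 2 by rewrite exprn_gt0.
have k2 : k ^+ 2 < 2^-1 ^+ 2 by rewrite ltr_pXn2r ?nnegrE //; lra.
set w := 2 * k ^+ 3; have w1 : 0 < 1 - w by rewrite /w; lra.
set r := Num.sqrt (1 - w); set th := (1 - k) / (1 + k).
have r0 : 0 < r by rewrite sqrtr_gt0.
have r2 : r ^+ 2 = 1 - w by rewrite sqr_sqrtr // ltW.
rewrite -r2; apply: ellipse_ratio_roots_le => //.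
  by rewrite /th divr_ge0 ?ltr_pdivrMr /=; lra.
set c := 1 + _.
have kp : 0 < 1 + k by lra.
have kn : 1 + k != 0 by rewrite gt_eqF.
have thp : 1 + th = 2 / (1 + k) by rewrite /th; field.
have thm : 1 - th = 2 * k / (1 + k) by rewrite /th; field.
have cE : c = (2 * k + w * (1 - k)) / (1 + k).
  by rewrite /c r2 /th; field.
have w0 : 0 < w by rewrite /w; lra.
have c0 : 0 < c.
  by rewrite cE divr_gt0 // addr_gt0 ?mulr_gt0 // subr_gt0; lra.
have cle : c * (1 + k) <= 2 * k * (1 + k ^+ 2).
  rewrite cE divfK // /w; have : 0 < k ^+ 3 * k by rewrite mulr_gt0.
  nra.
have dE : L - mu = S * (1 - 8 * k ^+ 2).
  have -> : S * (1 - 8 * k ^+ 2) = S - 2 * (4 * k ^+ 2 * S) by ring.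
  by rewrite -muE /S; ring.
set u := 1 - 8 * k ^+ 2 in dE.
have px : (S - 2 * x) ^+ 2 <= (S * u) ^+ 2.
  rewrite -dE -subr_ge0.
  have -> : (L - mu) ^+ 2 - (S - 2 * x) ^+ 2 = 4 * ((x - mu) * (L - x)).
    by rewrite /S; ring.
  by rewrite !mulr_ge0 // subr_ge0.
have py : y ^+ 2 <= S ^+ 2 * u.
  have -> : S ^+ 2 * u = L ^+ 2 - mu ^+ 2 by rewrite expr2 -mulrA -dE /S; ring.
  have s0 : 0 <= L ^+ 2 - mu ^+ 2 by rewrite subr_ge0 ler_sqr ?nnegrE; lra.
  rewrite -(sqr_sqrtr s0) -[y ^+ 2]real_normK ?num_real //.
  by rewrite ler_sqr ?nnegrE ?sqrtr_ge0 // ler_norml.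
have u0 : 0 < u by rewrite -(pmulr_rgt0 _ S0) -dE subr_gt0.
set G := c * (1 + k) in cle; have G0 : 0 < G by rewrite mulr_gt0.
pose N := 4 / (S ^+ 2 * (1 + k) ^+ 4).
have N0 : 0 <= N by rewrite divr_ge0 // mulr_ge0 ?exprn_ge0 ?ltW.
have Sn : S != 0 by rewrite gt_eqF.
have -> : (c - 2 * c / S * x) ^+ 2 * (1 + th) ^+ 2
    + (- (2 * c / S * y)) ^+ 2 * (1 - th) ^+ 2
  = N * (G ^+ 2 * ((S - 2 * x) ^+ 2 + 4 * k ^+ 2 * y ^+ 2)).
  by rewrite thp thm /N /G; field; rewrite Sn kn.
have -> : r ^+ 2 * ((1 - th) * (1 + th)) ^+ 2
  = N * (4 * k ^+ 2 * (1 - w) * S ^+ 2).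
  by rewrite r2 thp thm /N; field; rewrite Sn kn.
rewrite ler_wpM2l //.
have G2 : G ^+ 2 <= (2 * k * (1 + k ^+ 2)) ^+ 2.
  by rewrite ler_sqr ?nnegrE ?(ltW G0) // (le_trans (ltW G0)).
have B : (S - 2 * x) ^+ 2 + 4 * k ^+ 2 * y ^+ 2
    <= S ^+ 2 * (u * (1 - 4 * k ^+ 2)).
  have : k ^+ 2 * y ^+ 2 <= k ^+ 2 * (S ^+ 2 * u) by rewrite ler_pM2l.
  by rewrite /u in px *; lra.
have B0 : 0 <= (S - 2 * x) ^+ 2 + 4 * k ^+ 2 * y ^+ 2.
  by rewrite addr_ge0 ?sqr_ge0 // mulr_ge0 ?sqr_ge0 // ltW // mulr_gt0.
apply: le_trans (ler_pM (sqr_ge0 _) B0 G2 B) _.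
have -> : (2 * k * (1 + k ^+ 2)) ^+ 2 * (S ^+ 2 * (u * (1 - 4 * k ^+ 2)))
  = 4 * k ^+ 2 * S ^+ 2 * ((1 + k ^+ 2) ^+ 2 * u * (1 - 4 * k ^+ 2)) by ring.
rewrite [leRHS]mulrAC ler_wpM2l //.
  by rewrite mulr_ge0 ?sqr_ge0 // ltW // mulr_gt0.
(* Weakening [1 - w] to [1 - k^2], possible as [k < 1/2], leaves an inequality in [k^2] alone. *)
have wk : w <= k ^+ 2.
  rewrite /w exprSr; have : k ^+ 2 * k <= k ^+ 2 * 2^-1 by rewrite ler_pM2l // ltW.
  lra.
apply: (@le_trans _ _ (1 - k ^+ 2)); last lra.
rewrite /u in u0 *; move: (k ^+ 2) k20 u0 => g g0 g1.
have : 0 < g * (1 - 8 * g) by rewrite mulr_gt0 //; lra.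
have : 0 < g * g by rewrite mulr_gt0.
nra.
Qed.

(** An explicit negative momentum that beats [nonneg_momentum_bound]: the axis ratio is [1 / s] with
    [s^2 = kappa], and [r^2 = 1 - 1 / W] where [W < s^4 = kappa^2]. *)
Lemma feasible_K_hat_gap mu L : 0 < mu -> mu < L ->
  exists eta beta r, [/\ 0 < r < 1, r ^+ 2 * L ^+ 2 < L ^+ 2 - mu ^+ 2
    & feasible (K_hat mu L) eta beta r].
Proof.
move=> mu0 muL.
pose s := Num.sqrt (L / mu).
have kap : 1 < L / mu by rewrite ltr_pdivlMr // mul1r.
have s0 : 0 < s by rewrite sqrtr_gt0; lra.
have s2 : s ^+ 2 = L / mu by rewrite sqr_sqrtr; lra.
have s1 : 1 < s by rewrite -(@ltr_pXn2r _ 2) ?nnegrE ?ler01 ?ltW // expr1n s2.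
have LE : L = mu * s ^+ 2 by rewrite s2 mulrC divfK // gt_eqF.
(* For fixed [c], the choice of [D] makes [eta] minimise the ellipse form at the corner. [W] lies
   below [s^4] for the gap, yet is large enough for the final polynomial inequality. *)
pose W := s ^+ 3 + s - 1; pose D := s ^+ 4 + s ^+ 2 - 1.
have s30 : 1 < s ^+ 3 by rewrite exprn_egt1.
have s40 : 1 < s ^+ 4 by rewrite exprn_egt1.
have s20 : 1 < s ^+ 2 by rewrite exprn_egt1.
have W1 : 1 < W by rewrite /W; lra.
have W0 : 0 < W by lra.
have D0 : 0 < D by rewrite /D; lra.
pose r := Num.sqrt ((W - 1) / W); pose th := (s - 1) / (s + 1).
have r2 : r ^+ 2 = (W - 1) / W by rewrite sqr_sqrtr // divr_ge0 //; lra.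
have r0 : 0 < r by rewrite sqrtr_gt0 divr_gt0 //; lra.
have r1 : r < 1.
  rewrite -(@ltr_pXn2r _ 2) ?nnegrE ?ler01 ?ltW // expr1n r2.
  by rewrite ltr_pdivrMr // mul1r; lra.
pose c := 1 - r ^+ 2 * th.
exists (c * s ^+ 2 / (mu * D)), (- (r ^+ 2 * th)), r; split; first by rewrite r0.
  rewrite r2 LE -subr_gt0.
  have -> : (mu * s ^+ 2) ^+ 2 - mu ^+ 2 - (W - 1) / W * (mu * s ^+ 2) ^+ 2
    = mu ^+ 2 * (s ^+ 4 - W) / W by field; rewrite gt_eqF.
  have -> : s ^+ 4 - W = (s - 1) * (s ^+ 3 - 1) by rewrite /W; ring.
  by rewrite divr_gt0 // !mulr_gt0 ?exprn_gt0 // subr_gt0.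
move=> [x y] [/= xy mux].
rewrite momentum_trace; apply: ellipse_ratio_roots_le => //.
  by rewrite /th divr_ge0 ?ltr_pdivrMr /=; lra.
rewrite -/c.
have sn : s + 1 != 0 by rewrite gt_eqF //; lra.
have Dn : D != 0 by rewrite gt_eqF.
have Wn : W != 0 by rewrite gt_eqF.
have mun : mu != 0 by rewrite gt_eqF.
have thp : 1 + th = 2 * s / (s + 1) by rewrite /th; field.
have thm : 1 - th = 2 / (s + 1) by rewrite /th; field.
have cE : c = (2 * W + s - 1) / (W * (s + 1)).
  by rewrite /c r2 /th; field; rewrite Wn sn.
pose X := x / mu; pose Y := y / mu.
have X1 : 1 < X by rewrite ltr_pdivlMr // mul1r.
have XY : X ^+ 2 + Y ^+ 2 < s ^+ 4.
  have -> : X ^+ 2 + Y ^+ 2 = (x ^+ 2 + y ^+ 2) / mu ^+ 2 by rewrite /X /Y; field.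
  rewrite ltr_pdivrMr ?exprn_gt0 //.
  have -> : s ^+ 4 * mu ^+ 2 = L ^+ 2 by rewrite LE; ring.
  have L0 : 0 <= L by lra.
  rewrite -(sqr_sqrtr (_ : 0 <= x ^+ 2 + y ^+ 2)) ?addr_ge0 ?sqr_ge0 //.
  by rewrite ltr_pXn2r ?nnegrE ?sqrtr_ge0.
have X2 : X < s ^+ 2.
  rewrite -(@ltr_pXn2r _ 2) ?nnegrE; [|by []|lra..].
  by rewrite -exprM; apply: le_lt_trans XY; rewrite lerDl sqr_ge0.
pose N := 4 / (s + 1) ^+ 2.
have N0 : 0 <= N by rewrite divr_ge0 // sqr_ge0.
have -> : (c - c * s ^+ 2 / (mu * D) * x) ^+ 2 * (1 + th) ^+ 2
    + (- (c * s ^+ 2 / (mu * D) * y)) ^+ 2 * (1 - th) ^+ 2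
  = N * s ^+ 2 * (c / D) ^+ 2 * ((D - s ^+ 2 * X) ^+ 2 + s ^+ 2 * Y ^+ 2).
  by rewrite thp thm /X /Y /N; field; rewrite mun Dn sn.
have -> : r ^+ 2 * ((1 - th) * (1 + th)) ^+ 2
  = N * s ^+ 2 * (4 * r ^+ 2 / (s + 1) ^+ 2).
  by rewrite thp thm /N; field; rewrite sn.
have P0 : 0 <= N * s ^+ 2 by rewrite mulr_ge0 ?sqr_ge0.
(* The right side is the value at the corner [X = 1], [Y^2 = s^4 - 1]; elsewhere the form is smaller
   by at least a nonnegative multiple of [X - 1]. *)
have A : (D - s ^+ 2 * X) ^+ 2 + s ^+ 2 * Y ^+ 2 <= (s ^+ 4 - 1) * D.
  have : s ^+ 2 * Y ^+ 2 <= s ^+ 2 * (s ^+ 4 - X ^+ 2).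
    by rewrite ler_wpM2l ?sqr_ge0 //; lra.
  have : 0 <= s ^+ 2 * ((X - 1) * (2 * D - (s ^+ 2 - 1) * (X + 1))).
    apply: mulr_ge0; first exact: sqr_ge0.
    apply: mulr_ge0; first lra.
    have : (s ^+ 2 - 1) * (X + 1) <= (s ^+ 2 - 1) * (s ^+ 2 + 1).
      by apply: ler_wpM2l; lra.
    by rewrite /D; lra.
  by rewrite /D; lra.
rewrite -[leLHS]mulrA ler_wpM2l //.
apply: le_trans (ler_wpM2l (sqr_ge0 _) A) _.
rewrite -subr_ge0.
have -> : 4 * r ^+ 2 / (s + 1) ^+ 2 - (c / D) ^+ 2 * ((s ^+ 4 - 1) * D)
  = (4 * W * (W - 1) * D - (2 * W + s - 1) ^+ 2 * (s ^+ 4 - 1))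
    / (D * W ^+ 2 * (s + 1) ^+ 2).
  by rewrite r2 cE; field; rewrite Dn Wn sn.
rewrite divr_ge0 //; last first.
  by rewrite mulr_ge0 ?sqr_ge0 // mulr_ge0 ?sqr_ge0 // ltW.
have u0 : 0 <= s - 1 by lra.
(* Expanded in powers of [s - 1], all coefficients are nonnegative. *)
have -> : 4 * W * (W - 1) * D - (2 * W + s - 1) ^+ 2 * (s ^+ 4 - 1)
  = 4 * (s - 1) ^+ 2 + 16 * (s - 1) ^+ 3 + 22 * (s - 1) ^+ 4
    + 12 * (s - 1) ^+ 5 + 3 * (s - 1) ^+ 6 by rewrite /W /D; ring.
by rewrite !addr_ge0 // mulr_ge0 ?exprn_ge0.
Qed.

End OptimalRate.

(** * Order of the optimal rates, and the sign of the optimal momentum *)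

Section Asymptotics.
Context {R : realType}.
Implicit Types (K : set R[i]) (mu L eta beta r k kappa : R) (l z : R[i]).
Local Notation normc := Normc.normc.

Lemma powRN3half kappa : 0 <= kappa ->
  kappa `^ (- (3 / 2)) = (Num.sqrt kappa ^+ 3)^-1.
Proof.
move=> k0; rewrite powRN mulrC powRrM powR12_sqrt //.
by rewrite powR_mulrn ?sqrtr_ge0.
Qed.

Lemma axis_ratio_le kappa : 0 < kappa -> axis_ratio kappa <= (Num.sqrt kappa)^-1.
Proof.
move=> k0; have k1 : 0 < kappa + 1 by lra.
rewrite lef_pV2 ?posrE ?mulr_gt0 ?sqrtr_gt0 //.
have : Num.sqrt kappa <= Num.sqrt (kappa + 1) by rewrite ler_sqrt; lra.
have := sqrtr_ge0 (kappa + 1); lra.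
Qed.

Lemma axis_ratio_ge kappa : 1 <= kappa ->
  (4 * Num.sqrt kappa)^-1 <= axis_ratio kappa.
Proof.
move=> k1; have k0 : 0 < kappa by lra.
have k10 : 0 < kappa + 1 by lra.
rewrite lef_pV2 ?posrE ?mulr_gt0 ?sqrtr_gt0 //.
have : Num.sqrt (kappa + 1) <= Num.sqrt (2 ^+ 2 * kappa) by rewrite ler_sqrt; lra.
by rewrite sqrtrM ?sqr_ge0 // sqrtr_sqr ger0_norm //; lra.
Qed.

Lemma axis_ratio_cube_bounds kappa : 1 <= kappa ->
  64^-1 * kappa `^ (- (3 / 2)) <= axis_ratio kappa ^+ 3 <= kappa `^ (- (3 / 2)).
Proof.
move=> k1; have k0 : 0 < kappa by lra.
have sk : 0 < Num.sqrt kappa by rewrite sqrtr_gt0.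
rewrite powRN3half ?(ltW k0) // -exprVn.
have -> : 64^-1 * (Num.sqrt kappa)^-1 ^+ 3 = (4 * Num.sqrt kappa)^-1 ^+ 3.
  by field; rewrite gt_eqF.
have a0 := axis_ratio_gt0 k0.
rewrite !ler_pXn2r ?nnegrE ?axis_ratio_le ?axis_ratio_ge ?(ltW a0) //.
Qed.

(** The threshold 9 is the one that [rate_lower_bound] requires. *)
Lemma one_minus_Theta_le (g : R -> R -> \bar R) c1 c2 : 0 < c1 -> c1 <= c2 ->
  (forall mu L, 0 < mu -> 9 * mu <= L ->
     ((1 - c2 * (L / mu) `^ (- (3 / 2)))%R%:E <= g mu L
       <= (1 - c1 * (L / mu) `^ (- (3 / 2)))%R%:E)%E) ->
  one_minus_Theta g.
Proof.
move=> c10 c12 h; exists c1, c2, 9; split=> // mu L mu0 muL.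
rewrite ler_pdivlMr // => /(h mu L mu0).
case: (g mu L) => [x| |]; rewrite ?leye_eq ?leeNy_eq ?andbF //= -?EFinB !lee_fin.
by lra.
Qed.

Lemma feasible_subset K K' eta beta r : K `<=` K' ->
  feasible K' eta beta r -> feasible K eta beta r.
Proof. by move=> KK' h l /KK' /h. Qed.

(** Common to the three regions: inclusion in the rectangle gives the upper bound, root bounds at
    [mu], [L] and the corner give the lower one. The latter are assumed instead of membership since
    [K_hat] contains none of these points. *)
Lemma one_minus_Theta_rho_hat (K : R -> R -> set R[i]) :
  (forall mu L, 0 < mu -> mu < L -> K mu L !=set0) ->
  (forall mu L, 0 < mu -> mu < L -> K mu L `<=` K2_hat mu L) ->
  (forall mu L eta beta r, 0 < mu -> mu < L -> feasible (K mu L) eta beta r ->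
    forall l, l \in [:: mu%:C%C; L%:C%C; (mu +i* Num.sqrt (L ^+ 2 - mu ^+ 2))%C] ->
    roots_le (1 + beta%:C%C - eta%:C%C * l) beta%:C%C r) ->
  one_minus_Theta (fun mu L => rho_hat (K mu L)).
Proof.
move=> K0 KK2 Kv.
(* 4 is the root of the 16 in [rate_lower_bound]; 1/64 comes from the cube of the axis ratio. *)
have c64 : (64^-1 : R) <= 4 by lra.
apply: one_minus_Theta_le c64 _; first by lra.
move=> mu L mu0 muL9; have muL : mu < L by lra.
have kap : 9 <= L / mu by rewrite ler_pdivlMr.
have kap0 : 0 < L / mu by lra.
have [|lo _] := andP (@axis_ratio_cube_bounds (L / mu) _); first lra.
apply/andP; split.
  apply: le_rho_hat; first exact: K0.
  move=> eta beta r h.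
  have sq0 : 0 < Num.sqrt (L / mu) by rewrite sqrtr_gt0.
  have P0 : 0 < (L / mu) `^ (- (3 / 2)) by rewrite powR_gt0.
  have P2 : ((L / mu) `^ (- (3 / 2))) ^+ 2 = (mu / L) ^+ 3.
    rewrite powRN3half ?(ltW kap0) // -exprVn -exprM mulnC exprM.
    by rewrite exprVn sqr_sqrtr ?(ltW kap0) // invf_div.
  set P := _ `^ _ in P0 P2 *.
  pose r' := Num.max r 2^-1.
  have [r1|r1] := leP 1 r; first lra.
  have L0 : 0 < L by lra.
  have low r1' : 2^-1 <= r1' < 1 -> feasible (K mu L) eta beta r1' -> 1 - r1' <= 4 * P.
    move=> /andP[a b] h'.
    have : (1 - r1') ^+ 2 * L ^+ 3 <= 16 * mu ^+ 3.
      apply: (@rate_lower_bound _ mu L eta beta) => //; rewrite ?a ?b //.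
      - by apply: (Kv _ _ _ _ _ mu0 muL h'); rewrite !inE eqxx.
      - by apply: (Kv _ _ _ _ _ mu0 muL h'); rewrite !inE eqxx orbT.
      - by apply: (Kv _ _ _ _ _ mu0 muL h'); rewrite !inE eqxx !orbT.
    rewrite -ler_pdivlMr ?exprn_gt0 // => hh.
    rewrite -(@ler_pXn2r _ 2) ?nnegrE //; [|lra|by rewrite mulr_ge0 // ltW].
    by apply: le_trans hh _; rewrite exprMn P2 expr_div_n; lra.
  have [r2|r2] := leP 2^-1 r.
    by have := low r; rewrite r2 r1 => /(_ isT h); lra.
  (* A radius below 1/2 is raised to 1/2, where the lower bound would give [1/2 <= 4 P]; but
     [kappa >= 9] makes [4 P] smaller. *)
  have P4 : 4 * P < 2^-1.
    rewrite -(@ltr_pXn2r _ 2) ?nnegrE //; [|by rewrite mulr_ge0 // ltW].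
    have : mu / L <= 9^-1 by rewrite ler_pdivrMr //; lra.
    have : 0 <= mu / L by rewrite divr_ge0 // ltW.
    rewrite exprMn P2 => q0 q9.
    have : (mu / L) ^+ 3 <= 9^-1 ^+ 3 by rewrite ler_pXn2r ?nnegrE.
    by lra.
  have [] : 1 - 2^-1 <= 4 * P.
    apply: low; first by lra.
    by move=> l Kl; apply: roots_le_mono (h l Kl); exact: ltW.
  by lra.
apply: (@le_trans _ _ (Num.sqrt (1 - 2 * axis_ratio (L / mu) ^+ 3))%:E).
  apply: feasible_rho_hat; apply: feasible_subset (KK2 _ _ mu0 muL) _.
  exact: feasible_K2.
have ah : axis_ratio (L / mu) < 2^-1 by apply: axis_ratio_lt_half; lra.
have a0 := axis_ratio_gt0 kap0.
rewrite lee_fin; apply: (@le_trans _ _ (1 - axis_ratio (L / mu) ^+ 3)); last lra.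
have a3 : axis_ratio (L / mu) ^+ 3 < 2^-1 ^+ 3 by rewrite ltr_pXn2r ?nnegrE //; lra.
have a30 : 0 < axis_ratio (L / mu) ^+ 3 by rewrite exprn_gt0.
rewrite -(@ler_pXn2r _ 2) ?nnegrE ?sqrtr_ge0 ?sqr_sqrtr //; [|lra..].
have := sqr_ge0 (axis_ratio (L / mu) ^+ 3); lra.
Qed.

Lemma vertex_normc mu L : 0 < mu -> mu < L ->
  normc (mu +i* Num.sqrt (L ^+ 2 - mu ^+ 2))%C = L.
Proof.
move=> mu0 muL; rewrite /= sqr_sqrtr; last by rewrite subr_ge0 ler_sqr ?nnegrE; lra.
by rewrite addrC subrK sqrtr_sqr gtr0_norm //; lra.
Qed.

Lemma K_hat_neq0 mu L : 0 < mu -> mu < L -> exists2 l, K_hat mu L l & l != 0.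
Proof.
move=> mu0 muL; exists ((mu + L) / 2)%:C%C.
  by split; rewrite ?normc_real /= ?ger0_norm; lra.
by rewrite eq_complex /= eqxx andbT gt_eqF //; lra.
Qed.

Lemma K1_hat_real mu L (x : R) : 0 < mu -> mu < L -> mu <= x <= L ->
  K1_hat mu L x%:C%C.
Proof.
move=> mu0 muL /andP[x1 x2]; have L0 : 0 < L by lra.
by split=> //=; rewrite mulr0 ?addr0 ?subr0 mulrC ler_pdivrMr ?mul1r.
Qed.

Lemma K1_hat_vertex mu L : 0 < mu -> mu < L ->
  K1_hat mu L (mu +i* Num.sqrt (L ^+ 2 - mu ^+ 2))%C.
Proof.
move=> mu0 muL; have L0 : 0 < L by lra.
have S0 : 0 < L ^+ 2 - mu ^+ 2 by rewrite subr_gt0 ltr_sqr ?nnegrE; lra.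
set s := Num.sqrt _; have s0 : 0 < s by rewrite sqrtr_gt0.
have E : L^-1 * mu + (L - mu) / L = 1 by field; rewrite gt_eqF.
have d0 : 0 <= (L - mu) / L by rewrite divr_ge0 //; lra.
have vE : (L - mu) / (L * s) * s = (L - mu) / L by field; rewrite !gt_eqF.
split=> //=; rewrite -/s vE.
  by rewrite E.
by lra.
Qed.

Lemma K1_hat_subset mu L : 0 < mu -> mu < L -> K1_hat mu L `<=` K2_hat mu L.
Proof.
move=> mu0 muL [x y] [/= x1]; have L0 : 0 < L by lra.
have S0 : 0 < L ^+ 2 - mu ^+ 2 by rewrite subr_gt0 ltr_sqr ?nnegrE; lra.
set s := Num.sqrt _; have s0 : 0 < s by rewrite sqrtr_gt0.
set a := _ / (L * s) => h1 h2.
have a0 : 0 < a by rewrite divr_gt0 ?mulr_gt0 //; lra.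
have xL : x <= L.
  have : L^-1 * x <= 1 by lra.
  by rewrite mulrC ler_pdivrMr // mul1r.
have as_ : a * s = 1 - L^-1 * mu by rewrite /a; field; rewrite !gt_eqF.
have mx : L^-1 * mu <= L^-1 * x by rewrite ler_pM2l ?invr_gt0.
split; first by rewrite /= x1.
apply/andP; split; rewrite -(ler_pM2l a0) ?mulrN as_ /=; lra.
Qed.

Lemma K2_hat_disk mu L l : 0 < mu -> mu < L ->
  mu <= complex.Re l -> normc l <= L -> K2_hat mu L l.
Proof.
move: l => [x y] mu0 muL mx; have L0 : 0 <= L by lra.
rewrite normc_le //= in mx *; move=> xy; have y2 := sqr_ge0 y.
split=> /=.
  rewrite mx /= -(@ler_pXn2r _ 2) ?nnegrE //; lra.
have : mu ^+ 2 <= x ^+ 2 by rewrite ler_sqr ?nnegrE; lra.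
rewrite -ler_norml => m2; rewrite -(@ler_pXn2r _ 2) ?nnegrE ?sqrtr_ge0 //.
by rewrite real_normK ?num_real // sqr_sqrtr; lra.
Qed.

Lemma K_hat_subset mu L : 0 < mu -> mu < L -> K_hat mu L `<=` K2_hat mu L.
Proof. by move=> mu0 muL l [lL mul]; apply: K2_hat_disk => //; exact: ltW. Qed.

(** An optimal pair with [beta >= 0] would achieve the radius of [feasible_K_hat_gap], which the
    corner forbids. *)
Lemma optimal_K_hat_beta_lt0 mu L eta beta : 0 < mu -> mu < L ->
  optimal_pair (K_hat mu L) eta beta -> beta < 0.
Proof.
move=> mu0 muL opt; rewrite ltNge; apply/negP => b0.
have [eta' [beta' [r [r01 gap feas]]]] := feasible_K_hat_gap mu0 muL.
have : feasible (K_hat mu L) eta beta r.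
  by apply/worst_radius_le; rewrite opt; exact: feasible_rho_hat feas.
move=> /(feasible_K_hat mu0 muL) h.
have := h (mu +i* Num.sqrt (L ^+ 2 - mu ^+ 2))%C.
rewrite vertex_normc // !lexx => /(_ isT isT) hv.
by have := nonneg_momentum_bound mu0 muL b0 r01 hv; rewrite leNgt gap.
Qed.

End Asymptotics.

(** * Local convergence *)

Section AdaptedNorm.
Context {R : realType}.
Local Notation normc := Normc.normc.
Local Notation C := R[i].

Definition cnorm n (v : 'rV[C]_n) : R := \sum_j normc (v 0 j).

Lemma cnorm_ge0 n (v : 'rV[C]_n) : 0 <= cnorm v.
Proof. by apply: sumr_ge0 => j _; exact: normc_ge0. Qed.

Lemma cnormD n (u v : 'rV[C]_n) : cnorm (u + v) <= cnorm u + cnorm v.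
Proof.
by rewrite /cnorm -big_split ler_sum //= => j _; rewrite mxE le_normcD.
Qed.

Lemma cnormZ n (a : C) (v : 'rV[C]_n) : cnorm (a *: v) = normc a * cnorm v.
Proof.
by rewrite /cnorm mulr_sumr; apply: eq_bigr => j _; rewrite mxE Normc.normcM.
Qed.

Lemma cnorm0 n : cnorm (0 : 'rV[C]_n) = 0.
Proof. by rewrite /cnorm big1 // => j _; rewrite mxE Normc.normc0. Qed.

Lemma normc_sum (I : finType) (f : I -> C) :
  normc (\sum_i f i) <= \sum_i normc (f i).
Proof.
elim/big_ind2 : _ => // [|x x' y y' h h']; first by rewrite Normc.normc0.
by apply: le_trans (le_normcD _ _) _; exact: lerD.
Qed.

Lemma cnorm_mulmx m n (A : 'M[C]_(m, n)) :
  exists2 c : R, 0 <= c & forall v, cnorm (v *m A) <= c * cnorm v.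
Proof.
exists (\sum_i \sum_j normc (A i j)) => [|v].
  by apply: sumr_ge0 => i _; apply: sumr_ge0 => j _; exact: normc_ge0.
have le_v i : normc (v 0 i) <= cnorm v.
  rewrite /cnorm (bigD1 i) //= lerDl sumr_ge0 // => j _; exact: normc_ge0.
rewrite exchange_big mulr_suml; apply: ler_sum => j _.
rewrite mxE; apply: le_trans (normc_sum _) _.
rewrite mulr_suml; apply: ler_sum => i _.
by rewrite Normc.normcM mulrC ler_wpM2l ?normc_ge0.
Qed.

(* Passing to [v (A - z)] for one eigenvalue [z] at a time, with weights [w^k]
   that grow fast enough to absorb the coupling [v A = z v + v (A - z)]. *)
Fixpoint chain_norm n (A : 'M[C]_n) (w : R) (zs : seq C) (v : 'rV[C]_n) : R :=
  if zs is z :: zs' then cnorm v + w * chain_norm A w zs' (v *m (A - z%:M))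
  else 0.

Section ChainNorm.
Variables (n : nat) (A : 'M[C]_n) (w : R).
Hypothesis w0 : 0 <= w.

Lemma chain_norm_ge0 zs v : 0 <= chain_norm A w zs v.
Proof.
elim: zs v => [|z zs IH] v //=.
by rewrite addr_ge0 ?cnorm_ge0 // mulr_ge0.
Qed.

Lemma chain_normD zs u v :
  chain_norm A w zs (u + v) <= chain_norm A w zs u + chain_norm A w zs v.
Proof.
elim: zs u v => [|z zs IH] u v /=; first by rewrite addr0.
rewrite mulmxDl addrACA -mulrDr lerD ?cnormD //.
by rewrite ler_wpM2l.
Qed.

Lemma chain_norm_le zs :
  exists2 c, 0 <= c & forall v, chain_norm A w zs v <= c * cnorm v.
Proof.
elim: zs => [|z zs [c c0 hc]]; first by exists 0 => // v; rewrite mul0r.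
have [b b0 hb] := cnorm_mulmx (A - z%:M).
exists (1 + w * (c * b)) => [|v] /=.
  by rewrite addr_ge0 // !mulr_ge0.
rewrite mulrDl mul1r lerD2l -mulrA ler_wpM2l //.
by apply: le_trans (hc _) _; rewrite -mulrA ler_wpM2l.
Qed.

Definition chain_mx zs : 'M[C]_n :=
  foldr (fun z P => (A - z%:M) *m P) 1%:M zs.

Lemma cnorm_le_chain zs v : v *m chain_mx zs = 0 ->
  cnorm v <= chain_norm A w zs v.
Proof.
case: zs => [|z zs] /=; first by rewrite mulmx1 => ->; rewrite cnorm0.
by move=> _; rewrite lerDl mulr_ge0 // chain_norm_ge0.
Qed.

(** The extra term [(r' - r) * cnorm v] is what makes the induction work: multiplied by [w], the one
    for [v1 = v (A - z)] pays for the coupling term in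
    [cnorm (v *m A) <= r * cnorm v + cnorm v1]. *)
Lemma chain_norm_contract r r' zs v : (forall z, z \in zs -> normc z <= r) ->
  1 <= w * (r' - r) -> v *m chain_mx zs = 0 ->
  chain_norm A w zs (v *m A) + (r' - r) * cnorm v <= r' * chain_norm A w zs v.
Proof.
elim: zs v => [|z zs IH] v hz w1 /=.
  by rewrite mulmx1 => ->; rewrite cnorm0 !mulr0 addr0.
rewrite mulmxA; set v1 := v *m (A - z%:M) => v10.
have -> : v *m A *m (A - z%:M) = v1 *m A.
  by rewrite /v1 -!mulmxA; congr (v *m _);
     rewrite mulmxBl mulmxBr scalar_mxC.
have {}IH : chain_norm A w zs (v1 *m A) + (r' - r) * cnorm v1
    <= r' * chain_norm A w zs v1.
  by apply: IH => // y yzs; apply: hz; rewrite inE yzs orbT.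
have vA : cnorm (v *m A) <= r * cnorm v + cnorm v1.
  have -> : v *m A = z *: v + v1.
    by rewrite /v1 mulmxBr mul_mx_scalar addrC subrK.
  apply: le_trans (cnormD _ _) _; rewrite lerD2r cnormZ.
  by rewrite ler_wpM2r ?cnorm_ge0 // hz // inE eqxx.
have h1 := ler_wpM2l w0 IH.
have h2 := ler_wpM2r (cnorm_ge0 v1) w1.
nra.
Qed.

End ChainNorm.

(** The list is that of the roots of the characteristic polynomial with multiplicity;
    Cayley-Hamilton makes the product vanish. *)
Lemma chain_mx_eigenvalues n (A : 'M[C]_n.+1) :
  exists2 zs, chain_mx A zs = 0 & forall z, z \in zs -> eigenvalue A z.
Proof.
have [zs] := closed_field_poly_normal (char_poly A).
rewrite (monicP (char_poly_monic A)) scale1r => E.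
exists zs; last first.
  by move=> z zzs; rewrite eigenvalue_root_char E root_prod_XsubC.
have := Cayley_Hamilton A; rewrite E => <-.
rewrite /chain_mx; elim: zs {E} => [|z zs IH] /=; first by rewrite big_nil [RHS]rmorph1.
rewrite big_cons rmorphM /= IH mulmxE; congr (_ * _).
by rewrite rmorphB /= horner_mx_X horner_mx_C.
Qed.

Lemma adapted_norm n (A : 'M[C]_n) (r r' : R) : r < r' ->
  (forall z, eigenvalue A z -> normc z <= r) ->
  exists (N : 'rV[C]_n -> R) (c : R), 0 <= c /\
    [/\ forall v, cnorm v <= N v, forall v, N v <= c * cnorm v,
        forall u v, N (u + v) <= N u + N v & forall v, N (v *m A) <= r' * N v].
Proof.
case: n A => [|n] A rr' hA.
  have v0 (v : 'rV[C]_0) : cnorm v = 0 by rewrite /cnorm big_ord0.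
  exists (fun=> 0), 0; split=> //; split=> *; rewrite ?v0 ?mulr0 ?addr0 //.
have [zs zs0 hzs] := chain_mx_eigenvalues A.
pose w := (r' - r)^-1.
have d0 : 0 < r' - r by rewrite subr_gt0.
have w0 : 0 <= w by rewrite invr_ge0 ltW.
have vzs (v : 'rV_n.+1) : v *m chain_mx A zs = 0 by rewrite zs0 mulmx0.
have [c c0 hc] := chain_norm_le A w0 zs.
exists (chain_norm A w zs), c; split=> //; split=> // [v|u v|v].
- exact: cnorm_le_chain.
- exact: chain_normD.
have := @chain_norm_contract n.+1 A w w0 r r' zs v.
move=> /(_ (fun z zzs => hA z (hzs z zzs))); rewrite mulVf ?gt_eqF // lexx.
move=> /(_ isT (vzs v)); apply: le_trans.
by rewrite lerDl mulr_ge0 ?cnorm_ge0 // ltW.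
Qed.

End AdaptedNorm.

(** * Comparison of the Euclidean, sum and sup norms *)

Section EuclideanNorm.
Context {R : realType} {d : nat}.
Implicit Types (x y z u v : 'rV[R]_d).

(** A bridge between [norm2], the sup norm of the library and [cnorm], with which it agrees on real
    vectors. *)
Definition norm1 v : R := \sum_i `|v 0 i|.

Lemma dotpC x y : dotp x y = dotp y x.
Proof. by apply: eq_bigr => i _; rewrite mulrC. Qed.

Lemma dotpDl x y z : dotp (x + y) z = dotp x z + dotp y z.
Proof.
by rewrite /dotp -big_split; apply: eq_bigr => i _ /=; rewrite mxE mulrDl.
Qed.

Lemma dotpZl (a : R) x y : dotp (a *: x) y = a * dotp x y.
Proof. by rewrite /dotp mulr_sumr; apply: eq_bigr => i _; rewrite mxE mulrA. Qed.

Lemma dotpDr x y z : dotp z (x + y) = dotp z x + dotp z y.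
Proof. by rewrite !(dotpC z) dotpDl. Qed.

Lemma dotpZr (a : R) x y : dotp y (a *: x) = a * dotp y x.
Proof. by rewrite !(dotpC y) dotpZl. Qed.

Lemma dotp_ge0 x : 0 <= dotp x x.
Proof. by apply: sumr_ge0 => i _; rewrite -expr2 sqr_ge0. Qed.

Lemma dotp_eq0 x : dotp x x == 0 -> x = 0.
Proof.
rewrite psumr_eq0 => [/allP h|i _]; last by rewrite -expr2 sqr_ge0.
apply/rowP => i; rewrite mxE; apply/eqP.
by have := h i; rewrite mem_index_enum -expr2 sqrf_eq0 => /(_ isT).
Qed.

Lemma norm2_sqr x : norm2 x ^+ 2 = dotp x x.
Proof. by rewrite sqr_sqrtr // dotp_ge0. Qed.

Lemma norm2_ge0 x : 0 <= norm2 x.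
Proof. exact: sqrtr_ge0. Qed.

Lemma norm1_ge0 x : 0 <= norm1 x.
Proof. by apply: sumr_ge0. Qed.

Lemma coord_le_norm1 x i : `|x 0 i| <= norm1 x.
Proof. by rewrite /norm1 (bigD1 i) //= lerDl sumr_ge0. Qed.

Lemma norm1Z (a : R) x : norm1 (a *: x) = `|a| * norm1 x.
Proof. by rewrite /norm1 mulr_sumr; apply: eq_bigr => i _; rewrite mxE normrM. Qed.

Lemma dotp_le_norm1 x y : `|dotp x y| <= norm1 x * norm1 y.
Proof.
apply: le_trans (ler_norm_sum _ _ _) _; rewrite mulr_suml; apply: ler_sum => i _.
by rewrite normrM ler_wpM2l // coord_le_norm1.
Qed.

Lemma norm2_le_norm1 x : norm2 x <= norm1 x.
Proof.
rewrite -(@ler_pXn2r _ 2) ?nnegrE ?norm2_ge0 ?norm1_ge0 // norm2_sqr.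
by rewrite expr2; apply: le_trans (dotp_le_norm1 _ _); exact: ler_norm.
Qed.

Lemma norm1_le_norm2 x : norm1 x <= d%:R * norm2 x.
Proof.
have h i : `|x 0 i| <= norm2 x.
  rewrite -(@ler_pXn2r _ 2) ?nnegrE ?norm2_ge0 // norm2_sqr real_normK ?num_real //.
  by rewrite /dotp (bigD1 i) //= -expr2 lerDl sumr_ge0 // => j _; rewrite -expr2 sqr_ge0.
apply: le_trans (ler_sum _ (fun i _ => h i)) _.
by rewrite sumr_const card_ord mulr_natl.
Qed.

Lemma norm_le_norm1 x : `|x| <= norm1 x.
Proof.
rewrite [leLHS]mx_normrE; apply/bigmax_leP; split; first exact: norm1_ge0.
by move=> [i j] _ /=; rewrite ord1 coord_le_norm1.
Qed.

Lemma norm1_le_norm x : norm1 x <= d%:R * `|x|.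
Proof.
have h i : `|x 0 i| <= `|x|.
  by rewrite [leRHS]mx_normrE; apply: (le_bigmax _ _ (ord0, i)).
apply: le_trans (ler_sum _ (fun i _ => h i)) _.
by rewrite sumr_const card_ord mulr_natl.
Qed.

End EuclideanNorm.

(** * Monotonicity and Lipschitz bounds for the Jacobian *)

Section Linearization.
Context {R : realType} {d : nat}.
Variables (F : 'rV[R]_d -> 'rV[R]_d) (zs : 'rV[R]_d).
Hypothesis dF : differentiable F zs.

(** The tolerance is divided by [d + 1] to pay for the passage from the sup norm to [norm1]; the
    added 1 covers [d = 0]. *)
Lemma jacobian_approx (e : R) : 0 < e -> exists2 t : R, 0 < t & forall h,
  norm1 h < t -> norm1 (F (zs + h) - F zs - h *m jacobian F zs) <= e * norm1 h.
Proof.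
move=> e0; have d0 : 0 < d%:R + 1 :> R by rewrite ltr_wpDl.
have /eqaddoP/(_ (e / (d%:R + 1)) (divr_gt0 e0 d0)) := diff_locally dF.
move=> /nbhs_norm0P [t /= t0 ht]; exists t => // h hh.
have := ht h (le_lt_trans (norm_le_norm1 h) hh).
rewrite /= !fctE /= [h + zs]addrC -(mul_rV_lin1 ('d F zs)) opprD addrA => le.
apply: le_trans (norm1_le_norm _) _.
have : (d%:R + 1) * `|F (zs + h) - F zs - h *m jacobian F zs| <= e * norm1 h.
  rewrite mulrC -ler_pdivlMr //; apply: le_trans le _.
  rewrite mulrAC ler_wpM2r ?invr_ge0 ?(ltW d0) //.
  by rewrite ler_wpM2l ?(ltW e0) // norm_le_norm1.
by apply: le_trans; rewrite ler_wpM2r // lerDl.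
Qed.

(** One difference quotient with a small error [w] lets the global inequalities on [F] pass to the
    Jacobian: divide by [t^2], then let [e] tend to 0. *)
Lemma jacobian_increment (v : 'rV[R]_d) (e : R) : 0 < e ->
  exists (t : R) (w : 'rV[R]_d), [/\ 0 < t,
    F (zs + t *: v) - F zs = t *: (v *m jacobian F zs + w) & norm1 w <= e].
Proof.
move=> e0; have n0 : 0 < norm1 v + 1 by rewrite ltr_wpDl // norm1_ge0.
have [s s0 hs] := jacobian_approx (divr_gt0 e0 n0).
pose t := s / (norm1 v + 1); have t0 : 0 < t by rewrite divr_gt0.
have := hs (t *: v); rewrite norm1Z gtr0_norm //.
set q := F _ - _ - _ => hq.
exists t, (t^-1 *: q); split=> //.
  rewrite scalerDr scalerA divff ?gt_eqF // scale1r scalemxAl.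
  by rewrite [RHS]addrC subrK.
rewrite norm1Z gtr0_norm ?invr_gt0 // mulrC ler_pdivrMr //.
apply: le_trans (hq _) _.
  by rewrite /t mulrAC ltr_pdivrMr // ltr_pM2l // ltrDl.
have -> : e / (norm1 v + 1) * (t * norm1 v)
  = e * t * (norm1 v / (norm1 v + 1)) by ring.
by rewrite ger_pMr; [rewrite ler_pdivrMr // mul1r lerDl | exact: mulr_gt0].
Qed.

Lemma jacobian_monotone mu v : strongly_monotone mu F ->
  mu * dotp v v <= dotp (v *m jacobian F zs) v.
Proof.
move=> hF; apply/ler_addgt0Pr => e e0.
have n0 : 0 < norm1 v + 1 by rewrite ltr_wpDl // norm1_ge0.
have [t [w [t0 E hw]]] := jacobian_increment v (divr_gt0 e0 n0).
have := hF (zs + t *: v) zs.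
rewrite E norm2_sqr [zs + _]addrC addrK !(dotpZl, dotpZr) dotpDl.
have -> : mu * (t * (t * dotp v v)) = t * (t * (mu * dotp v v)) by ring.
rewrite !ler_pM2l // => /le_trans; apply; rewrite lerD2l.
apply: le_trans (ler_norm _) (le_trans (dotp_le_norm1 _ _) _).
rewrite ler_pdivlMr // in hw; apply: le_trans hw.
by rewrite ler_wpM2l ?norm1_ge0 // lerDl.
Qed.

Lemma jacobian_lipschitz (L : R) v : 0 <= L -> lipschitz2 L F ->
  dotp (v *m jacobian F zs) (v *m jacobian F zs) <= L ^+ 2 * dotp v v.
Proof.
move=> L0 hF; apply/ler_addgt0Pr => e e0; set y := v *m _.
(* This denominator absorbs the cross term [2 * dotp y w]. *)
have n0 : 0 < 2 * norm1 y + 1 by rewrite ltr_wpDl // mulr_ge0 // norm1_ge0.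
have [t [w [t0 E hw]]] := jacobian_increment v (divr_gt0 e0 n0).
have := hF (zs + t *: v) zs; rewrite E [zs + _]addrC addrK -/y.
rewrite -(@ler_pXn2r _ 2) ?nnegrE ?mulr_ge0 ?norm2_ge0 // exprMn !norm2_sqr.
rewrite !(dotpZl, dotpZr) !dotpDl !dotpDr [dotp w y]dotpC.
have -> : L ^+ 2 * (t * (t * dotp v v)) = t * (t * (L ^+ 2 * dotp v v)) by ring.
rewrite !ler_pM2l // => h.
have hyw : - dotp y w <= norm1 y * norm1 w.
  by apply: le_trans (ler_norm _) _; rewrite normrN dotp_le_norm1.
have := dotp_ge0 w; have := norm1_ge0 w.
rewrite ler_pdivlMr // in hw; lra.
Qed.

End Linearization.

(** * The linearised iteration and its spectrum *)

Section PolyakMatrix.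
Variables (T : comNzRingType) (d : nat).
Implicit Types (J : 'M[T]_d) (eta beta : T) (x y : 'rV[T]_d).

(** Acts from the right, as [jacobian] does, on the row of two consecutive errors. *)
Definition polyak_mx J eta beta : 'M[T]_(d + d) :=
  block_mx 0 (- beta)%:M 1%:M ((1 + beta)%:M - eta *: J).

Lemma mul_row_polyak_mx J eta beta x y :
  row_mx x y *m polyak_mx J eta beta
  = row_mx y (- beta *: x + (1 + beta) *: y - eta *: (y *m J)).
Proof.
rewrite mul_row_block mulmx0 mulmx1 add0r mulmxBr !mul_mx_scalar -scalemxAr.
by rewrite addrA.
Qed.

End PolyakMatrix.

Lemma map_polyak_mx (T U : comNzRingType) (f : {rmorphism T -> U}) d
    (J : 'M[T]_d) eta beta :
  map_mx f (polyak_mx J eta beta) = polyak_mx (map_mx f J) (f eta) (f beta).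
Proof.
rewrite /polyak_mx map_block_mx map_mx0 map_mxB map_mxZ !map_scalar_mx.
by rewrite rmorphN rmorphD rmorph1.
Qed.

Section Eigenvalues.
Context {R : realType} {d : nat}.
Implicit Types (J : 'M[R]_d) (mu L eta beta r : R) (l z : R[i]).
Local Notation normc := Normc.normc.
Local Notation toC := (real_complex R).

(** For an eigenvector [x + i y], add the real inequalities at [x] and at [y]: the cross terms
    cancel, leaving [Re l] and [|l|^2] times [dotp x x + dotp y y]. *)
Lemma eigenvalue_numerical_range J mu L l : 0 <= L ->
  (forall v, mu * dotp v v <= dotp (v *m J) v) ->
  (forall v, dotp (v *m J) (v *m J) <= L ^+ 2 * dotp v v) ->
  eigenvalue (map_mx toC J) l -> mu <= complex.Re l /\ normc l <= L.
Proof.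
move=> L0 hmu hL /eigenvalueP [u uJ u0].
pose join (p q : 'rV[R]_d) := map_mx toC p + 'i%C *: map_mx toC q.
have joinE p q j : join p q 0 j = (p 0 j +i* q 0 j)%C.
  by rewrite !mxE; apply/eqP; rewrite eq_complex /=; apply/andP; split; apply/eqP; ring.
pose x := map_mx (@complex.Re R) u; pose y := map_mx (@complex.Im R) u.
have uE : u = join x y.
  by apply/rowP => j; rewrite joinE !mxE; case: (u 0 j).
have E : join (x *m J) (y *m J) = l *: join x y.
  by rewrite -uE -uJ uE /join mulmxDl -scalemxAl !map_mxM.
case: l E uJ => a b E _ /=.
have Ex : x *m J = a *: x - b *: y.
  apply/rowP => j; have /rowP/(_ j) := E; rewrite joinE [RHS]mxE joinE.
  by move/eqP; rewrite eq_complex /= => /andP[/eqP -> _]; rewrite !mxE.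
have Ey : y *m J = b *: x + a *: y.
  apply/rowP => j; have /rowP/(_ j) := E; rewrite joinE [RHS]mxE joinE.
  by move/eqP; rewrite eq_complex /= => /andP[_ /eqP ->]; rewrite !mxE addrC.
pose n := dotp x x + dotp y y.
have n0 : 0 < n.
  rewrite lt_def addr_ge0 ?dotp_ge0 // andbT.
  apply: contraNneq u0 => /eqP; rewrite paddr_eq0 ?dotp_ge0 // => /andP[].
  move=> /dotp_eq0 x0 /dotp_eq0 y0.
  by rewrite uE x0 y0 /join !map_mx0 scaler0 addr0.
have eqD : dotp (x *m J) x + dotp (y *m J) y = a * n.
  rewrite Ex Ey -scaleNr !dotpDl !dotpZl (dotpC y x) /n; ring.
have eqN : dotp (x *m J) (x *m J) + dotp (y *m J) (y *m J)
    = (a ^+ 2 + b ^+ 2) * n.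
  rewrite Ex Ey -scaleNr !(dotpDl, dotpDr) !(dotpZl, dotpZr) (dotpC y x) /n; ring.
split.
  have := lerD (hmu x) (hmu y); rewrite eqD -mulrDr -/n.
  by rewrite ler_pM2r.
have := lerD (hL x) (hL y); rewrite eqN -mulrDr -/n ler_pM2r //.
by rewrite -(@normc_le _ (a +i* b)%C).
Qed.

(** An eigenvector has the form [(x, z x)], and [x] is an eigenvector of [J] whose eigenvalue is
    found by solving the quadratic for [l]. This divides by [eta z]; [z != 0] follows from
    [beta != 0]. *)
Lemma eigenvalue_polyak_mx J eta beta z : eta != 0 -> beta != 0 ->
  eigenvalue (map_mx toC (polyak_mx J eta beta)) z ->
  exists2 l, eigenvalue (map_mx toC J) l
    & z ^+ 2 - (1 + beta%:C%C - eta%:C%C * l) * z + beta%:C%C = 0.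
Proof.
move=> eta0 beta0 /eigenvalueP [u].
rewrite map_polyak_mx /= -(hsubmxK u); move: (lsubmx u) (rsubmx u) => x y.
rewrite mul_row_polyak_mx scale_row_mx => e; have [yE zE] := eq_row_mx e.
move=> xy0; have x0 : x != 0.
  by apply: contraNneq xy0 => x0; rewrite yE x0 scaler0 row_mx0.
have eC : eta%:C%C != 0 by rewrite fmorph_eq0.
have bC : beta%:C%C != 0 by rewrite fmorph_eq0.
have z0 : z != 0.
  apply: contraNneq x0 => z0.
  move: zE; rewrite yE z0 !scale0r mul0mx !scaler0 addr0 subr0 => /eqP.
  by rewrite scaler_eq0 oppr_eq0 (negPf bC).
exists (- (z ^+ 2 - (1 + beta%:C%C) * z + beta%:C%C) / (eta%:C%C * z)); last first.
  by field; rewrite eC z0.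
apply/eigenvalueP; exists x => //.
have ez : eta%:C%C * z != 0 by rewrite mulf_neq0.
apply: (scalerI ez); rewrite scalerA mulrCA divff // mulr1.
move: zE; rewrite yE -scalemxAl; move: (x *m _) => v zE.
apply/rowP => j; have := congr1 (fun w : 'rV_d => w 0 j) zE; rewrite !mxE => h.
apply/eqP; rewrite -subr_eq0; apply/eqP.
transitivity (z * (z * x 0 j) - (- beta%:C%C * x 0 j
  + (1 + beta%:C%C) * (z * x 0 j) - eta%:C%C * (z * v 0 j))); first by ring.
by rewrite h subrr.
Qed.

End Eigenvalues.

(** * From the spectral bound to local convergence *)

Section LocalConvergence.
Context {R : realType}.
Local Notation normc := Normc.normc.
Local Notation toC := (real_complex R).

Lemma cnorm_real n (v : 'rV[R]_n) : cnorm (map_mx toC v) = norm1 v.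
Proof. by apply: eq_bigr => i _; rewrite mxE normc_real. Qed.

Lemma norm1_row_mx m n (x : 'rV[R]_m) (y : 'rV[R]_n) :
  norm1 (row_mx x y) = norm1 x + norm1 y.
Proof.
rewrite /norm1 big_split_ord /=; congr (_ + _); apply: eq_bigr => i _.
  by rewrite row_mxEl.
by rewrite row_mxEr.
Qed.

Lemma polyak_local_rate d (F : 'rV[R]_d -> 'rV[R]_d) zs mu L eta beta r rate :
  differentiable F zs -> F zs = 0 -> strongly_monotone mu F -> lipschitz2 L F ->
  0 < mu -> mu < L -> eta != 0 -> beta != 0 ->
  feasible (K2_hat mu L) eta beta r -> r < rate -> rate <= 1 ->
  exists (U : set 'rV[R]_d) (C : R), nbhs zs U /\ forall z0, U z0 -> forall t,
    norm2 (polyak F eta beta z0 t - zs) <= C * rate ^+ t * norm2 (z0 - zs).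
Proof.
move=> dF F0 monF lipF mu0 muL eta0 beta0 feas rrate rate1.
set J := jacobian F zs; set M := polyak_mx J eta beta.
have L0 : 0 <= L by lra.
(* Half of the gap [rate - r] is spent on the adapted norm, half on the nonlinear remainder. *)
pose r1 := (r + rate) / 2.
have eigM z : eigenvalue (map_mx toC M) z -> normc z <= r.
  move=> /(eigenvalue_polyak_mx eta0 beta0)[l /eigenvalue_numerical_range hl hz].
  have [] := hl mu L L0; first by move=> v; exact: jacobian_monotone.
    by move=> v; exact: jacobian_lipschitz.
  by move=> lmu lL; exact: (feas l (K2_hat_disk mu0 muL lmu lL)) hz.
have [|N [c [c0 [Nge Nle ND NM]]]] := @adapted_norm R _ (map_mx toC M) r r1 _ eigM.
  by rewrite /r1; lra.
have rate0 : 0 <= rate.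
  have [l lK] : K2_hat mu L !=set0.
    by exists mu%:C%C; apply: K2_hat_disk; rewrite ?normc_real ?ger0_norm //=; lra.
  move: lK => /feas /roots_le_ge0; lra.
have n0 (x : R) : 0 <= x -> 0 < x + 1 by lra.
have ce0 : 0 <= c * `|eta| by rewrite mulr_ge0.
pose e := (rate - r1) / (c * `|eta| + 1).
have e0 : 0 < e by rewrite divr_gt0 ?n0 // /r1; lra.
have ee : c * `|eta| * e <= rate - r1.
  have -> : c * `|eta| * e = (rate - r1) * (c * `|eta| / (c * `|eta| + 1)).
    by rewrite /e; ring.
  have rr : 0 < rate - r1 by rewrite /r1; lra.
  by rewrite ger_pMr // ler_pdivrMr ?n0 // mul1r lerDl.
have [s s0 approx] := jacobian_approx dF e0.
(* The pair [(z0, z0)] has adapted norm at most [2 c] times the initial error, so the orbit starts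
   where the linear approximation holds. *)
pose U := [set z | 2 * c * norm1 (z - zs) < s].
exists U, (2 * c * d%:R); split.
  apply/nbhs_ballP.
  have a0 : 0 <= 2 * c * d%:R by rewrite !mulr_ge0.
  exists (s / (2 * c * d%:R + 1)) => /=; first by rewrite divr_gt0 ?n0.
  move=> z; rewrite -ball_normE /= distrC ltr_pdivlMr ?n0 // => hz; rewrite /U /=.
  apply: le_lt_trans hz; apply: le_trans (_ : 2 * c * (d%:R * `|z - zs|) <= _).
    by rewrite ler_wpM2l ?norm1_le_norm // mulr_ge0.
  by rewrite mulrA mulrC ler_wpM2l // lerDl.
move=> z0 Uz0 t.
pose q t := iter t (polyak_step F eta beta) (z0, z0).
pose p t := row_mx ((q t).1 - zs) ((q t).2 - zs).
pose Np t := N (map_mx toC (p t)).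
have p_le k : norm1 ((q k).2 - zs) <= Np k.
  apply: le_trans (Nge _); rewrite cnorm_real norm1_row_mx lerDr.
  exact: norm1_ge0.
have Np_ge0 k : 0 <= Np k by apply: le_trans (p_le k); exact: norm1_ge0.
have Np0 : Np 0%N <= 2 * c * norm1 (z0 - zs).
  apply: le_trans (Nle _) _; rewrite cnorm_real /p norm1_row_mx /q /=.
  by move: (norm1 _) => x; lra.
have step k : norm1 ((q k).2 - zs) < s -> Np k.+1 <= rate * Np k.
  move=> /approx; set h := _ - zs; set g := F _ - F zs - _ => hg.
  have E : p k.+1 = p k *m M + row_mx 0 (- eta *: g).
    rewrite /p /= mul_row_polyak_mx -/h add_row_mx addr0; congr row_mx.
    rewrite /g F0 subr0 /h [zs + _]addrC subrK -/h -/J.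
    apply/rowP => j; rewrite !mxE; ring.
  rewrite /Np E map_mxD map_mxM; apply: le_trans (ND _ _) _.
  rewrite -[leRHS](subrK (r1 * Np k)) -mulrBl addrC lerD ?NM //.
  apply: le_trans (Nle _) _; rewrite cnorm_real norm1_row_mx norm1Z normrN.
  have -> : norm1 (0 : 'rV[R]_d) = 0 by rewrite /norm1 big1 // => i _; rewrite mxE normr0.
  rewrite add0r mulrA; apply: le_trans (ler_wpM2l ce0 hg) _.
  rewrite mulrA; apply: le_trans (_ : c * `|eta| * e * Np k <= _).
    by rewrite ler_wpM2l ?p_le // mulr_ge0 // ltW.
  by rewrite ler_wpM2r.
(* The estimate sustains itself: since [rate <= 1], it keeps the iterate within distance [s], where
   [step] applies. *)
have bound k : Np k <= rate ^+ k * Np 0%N.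
  elim: k => [|k IH]; first by rewrite expr0 mul1r.
  rewrite exprS -mulrA; apply: le_trans (step k _) _; last by rewrite ler_wpM2l.
  apply: le_lt_trans (p_le k) _; apply: le_lt_trans IH _.
  apply: le_lt_trans (_ : Np 0%N < s); first by rewrite ler_piMl // exprn_ile1.
  exact: le_lt_trans Np0 _.
apply: le_trans (norm2_le_norm1 _) _; apply: le_trans (p_le t) _.
apply: le_trans (bound t) _.
have -> : 2 * c * d%:R * rate ^+ t * norm2 (z0 - zs)
  = rate ^+ t * (2 * c * (d%:R * norm2 (z0 - zs))) by ring.
rewrite ler_wpM2l ?exprn_ge0 //; apply: le_trans Np0 _.
by rewrite ler_wpM2l ?norm1_le_norm2 // mulr_ge0.
Qed.

End LocalConvergence.

(** * Assembly for the three regions, and choice of the local rate *)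

Theorem theorem2 (R : realType) :
  (forall mu L : R, 0 < mu -> mu < L ->
    [/\ exists eta beta : R, optimal_pair (K_hat mu L) eta beta,
        exists eta beta : R, optimal_pair (K1_hat mu L) eta beta,
        exists eta beta : R, optimal_pair (K2_hat mu L) eta beta
      & forall eta beta : R,
          optimal_pair (K_hat mu L) eta beta -> beta < 0]) /\
  one_minus_Theta (fun mu L : R => rho_hat (K1_hat mu L)) /\
  one_minus_Theta (fun mu L : R => rho_hat (K2_hat mu L)) /\
  one_minus_Theta (fun mu L : R => rho_hat (K_hat mu L)) /\
  (exists (eta beta : R -> R -> R) (rate : R -> R),
    [/\ forall mu L : R, 0 < mu -> mu < L -> beta mu L < 0,
        forall kappa : R, 1 < kappa -> 0 <= rate kappa < 1,
        one_minus_Theta (fun mu L : R => (rate (L / mu))%:E)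
      & forall (mu L : R), 0 < mu -> mu < L ->
        forall (d : nat) (F : 'rV[R]_d -> 'rV[R]_d) (zstar : 'rV[R]_d),
          continuously_differentiable F ->
          strongly_monotone mu F ->
          lipschitz2 L F ->
          F zstar = 0 ->
          exists (U : set 'rV[R]_d) (C : R), nbhs zstar U /\
            forall z0 : 'rV[R]_d, U z0 -> forall t : nat,
              norm2 (polyak F (eta mu L) (beta mu L) z0 t - zstar)
                <= C * rate (L / mu) ^+ t * norm2 (z0 - zstar)]).
Proof.
have K1pt (mu L : R) l : 0 < mu -> mu < L ->
    l \in [:: mu%:C%C; L%:C%C; (mu +i* Num.sqrt (L ^+ 2 - mu ^+ 2))%C] ->
    K1_hat mu L l.
  move=> mu0 muL; rewrite !inE => /or3P[] /eqP ->; last exact: K1_hat_vertex.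
    by apply: K1_hat_real; rewrite ?lexx ?ltW.
  by apply: K1_hat_real; rewrite ?lexx ?ltW.
have mu_in (mu L : R) : 0 < mu -> mu < L -> exists2 l, K1_hat mu L l & l != 0.
  move=> mu0 muL; exists mu%:C%C; first by apply: K1pt; rewrite // !inE eqxx.
  by rewrite fmorph_eq0 gt_eqF.
split; first (move=> mu L mu0 muL; split).
- exact: (exists_optimal_pair (K_hat_neq0 mu0 muL)).
- exact: (exists_optimal_pair (mu_in mu L mu0 muL)).
- have [l Kl l0] := mu_in mu L mu0 muL.
  by apply: (@exists_optimal_pair R (K2_hat mu L)); exists l => //; exact: K1_hat_subset Kl.
- by move=> eta beta; exact: optimal_K_hat_beta_lt0.
split.
  apply: one_minus_Theta_rho_hat => [mu L mu0 muL|mu L|mu L eta beta r mu0 muL h l hl].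
  - by have [l Kl _] := mu_in mu L mu0 muL; exists l.
  - exact: K1_hat_subset.
  - by apply: h; exact: K1pt.
split.
  apply: one_minus_Theta_rho_hat => [mu L mu0 muL|mu L _ _|mu L eta beta r mu0 muL h l hl].
  - by have [l Kl _] := mu_in mu L mu0 muL; exists l; exact: K1_hat_subset Kl.
  - exact: subset_refl.
  - by apply: h; apply: K1_hat_subset => //; exact: K1pt.
split.
  apply: one_minus_Theta_rho_hat => [mu L mu0 muL|mu L|mu L eta beta r mu0 muL h l].
  - by have [l Kl _] := K_hat_neq0 mu0 muL; exists l.
  - exact: K_hat_subset.
  - have L0 : 0 < L := lt_trans mu0 muL.
    rewrite !inE => /or3P[] /eqP ->; apply: (feasible_K_hat mu0 muL h);
      by rewrite ?vertex_normc ?normc_real ?gtr0_norm //= ?lexx ?ltW.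
(* Strictly above the linear radius [sqrt (1 - 2 k^3)], to leave room for the remainder, yet of the
   same order. *)
pose rate (kappa : R) := 1 - axis_ratio kappa ^+ 3 / 2.
have rateP (kappa : R) : 1 < kappa -> 0 < axis_ratio kappa ^+ 3 < 8^-1.
  move=> k1; have k0 : 0 < kappa by lra.
  rewrite exprn_gt0 ?axis_ratio_gt0 //=.
  have -> : (8^-1 : R) = 2^-1 ^+ 3 by field.
  by rewrite ltr_pXn2r ?nnegrE ?axis_ratio_lt_half ?(ltW (axis_ratio_gt0 k0)).
exists K2_eta, (fun mu L => K2_beta (L / mu)), rate; split.
- by move=> mu L mu0 muL; apply: K2_beta_lt0; rewrite ltr_pdivlMr // mul1r.
- by move=> kappa /rateP /andP[]; rewrite /rate; lra.
(* 128 is twice the 64 of [axis_ratio_cube_bounds], because of the halved cube in [rate]. *)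
- have c128 : (128^-1 : R) <= 1 by lra.
  apply: one_minus_Theta_le c128 _; first by lra.
  move=> mu L mu0 muL; rewrite !lee_fin /rate.
  have [|lo hi] := andP (@axis_ratio_cube_bounds R (L / mu) _).
    by rewrite ler_pdivlMr //; lra.
  by apply/andP; split; lra.
move=> mu L mu0 muL d F zstar [dF _] monF lipF F0.
have kap : 1 < L / mu by rewrite ltr_pdivlMr // mul1r.
have /andP[w0 w1] := rateP _ kap.
have feas := feasible_K2 mu0 muL; set r := Num.sqrt _ in feas.
have r_lt : r < rate (L / mu).
  rewrite /r /rate; set w := axis_ratio _ ^+ 3 in w0 w1 *.
  rewrite -(@ltr_pXn2r _ 2) ?nnegrE ?sqrtr_ge0 ?sqr_sqrtr //; [|lra..].
  have := sqr_ge0 w; lra.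
apply: polyak_local_rate feas r_lt _ => //; last by rewrite /rate; lra.
  by rewrite gt_eqF // K2_eta_gt0.
by rewrite lt_eqF // K2_beta_lt0.
Qed.
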